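(* Let $\mathcal{K}\subseteq\mathbb{R}^d$ be nonempty, convex and compact with diameter $D=\max_{x,y\in\mathcal{K}}\|x-y\|$ and radius $R=\max_{x\in\mathcal{K}}\|x\|$. Let $F(x)=\mathbb{E}_{z\sim p(z)}[\tilde F(x;z)]$, where the distribution $p$ does not depend on $x$, and assume that for all $x,y\in\mathcal{K}$ and all $z\in\mathcal{Z}$: $|\tilde F(x;z)|\le B$, $\|\nabla\tilde F(x;z)\|\le G$, and $\|\nabla\tilde F(x;z)-\nabla\tilde F(y;z)\|\le L\|x-y\|$. Run the oblivious variant of the one-sample stochastic Frank-Wolfe method for $T$ iterations. Then: 1. If $F$ is convex on $\mathcal{K}$ with minimizer $x^*$ on $\mathcal{K}$, and the minimization update is used with $\rho_t=(t-1)^{-1}$ and $\eta_t=t^{-1}$, then $x_{T+1}\in\mathcal{K}$ and $\mathbb{E}[F(x_{T+1})-F(x^* )]\le\mathcal{O}(T^{-1/2})$. 2. If $F$ is (possibly) non-convex, and the minimization update is used with $\rho_t=(t-1)^{-2/3}$ and $\eta_t=T^{-2/3}$, and $x_o$ is chosen uniformly at random from $\{x_1,\dots,x_T\}$, then $x_o\in\mathcal{K}$ and $\mathbb{E}[\mathcal{G}(x_o)]\le\mathcal{O}(T^{-1/3})$, where $\mathcal{G}(x)=\max_{v\in\mathcal{K}}\langle v-x,-\nabla F(x)\rangle$. 3. If $0\in\mathcal{K}$, $F$ is nonnegative, monotone and continuous DR-submodular on a domain $\mathcal{X}=\prod_{i=1}^d\mathcal{X}_i\supseteq\mathcal{K}$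 with each $\mathcal{X}_i$ a compact subset of $\mathbb{R}_{\ge0}$, $x^*$ is a maximizer of $F$ on $\mathcal{K}$, and the DR-submodular maximization update is used with $x_1=0$, $\rho_t=(t-1)^{-1}$ and $\eta_t=T^{-1}$, then $x_{T+1}\in\mathcal{K}$ and $\mathbb{E}[F(x_{T+1})]\ge(1-e^{-1})F(x^* )-\mathcal{O}(T^{-1/2})$. Here $\mathcal{O}(T^{-s})$ denotes a quantity bounded by $c\,T^{-s}$ for all $T\ge1$, with $c$ depending only on $B,G,L,D,R$ (not on $T$).
   Context: Here $\tilde F:\mathbb{R}^d\times\mathcal{Z}\to\mathbb{R}$, $p$ is a probability distribution on $\mathcal{Z}$, gradients $\nabla$ are with respect to $x$, and $\|\cdot\|$ is the Euclidean norm. Standing assumptions: $F$ and $\tilde F(\cdot;z)$ are differentiable, all functions are measurable in $z$, and $\mathbb{E}_{z\sim p}[\nabla\tilde F(x;z)]=\nabla F(x)$ for all $x\in\mathcal{K}$. DR-submodularity: vector inequalities are coordinatewise. A differentiable $F:\mathcal{X}\to\mathbb{R}_{\ge0}$ is continuous DR-submodular if for all $x,y\in\mathcal{X}$ with $x\le y$ and every $i$, $\frac{\partial F}{\partial x_i}(x)\ge\frac{\partial F}{\partial x_i}(y)$; it is monotone if $F(x)\le F(y)$ whenever $x,y\in\mathcal{X}$, $x\le y$. Algorithm (oblivious one-sample stochastic Frank-Wolfe). Input: $\rho_t,\eta_t\in(0,1]$, a deterministic initial point $x_1\in\mathcal{K}$, number of iterations $T$. For $t=1,\dots,T$: - Sample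 $z_t\sim p$ independently of the past. - If $t=1$: $d_1=\nabla\tilde F(x_1;z_1)$. - If $t\ge2$: $\tilde\Delta_t=\nabla\tilde F(x_t;z_t)-\nabla\tilde F(x_{t-1};z_t)$ and $d_t=(1-\rho_t)(d_{t-1}+\tilde\Delta_t)+\rho_t\nabla\tilde F(x_t;z_t)$. - Minimization update: $v_t\in\arg\min_{v\in\mathcal{K}}v^\top d_t$, $x_{t+1}=x_t+\eta_t(v_t-x_t)$. DR-submodular maximization update: $v_t\in\arg\max_{v\in\mathcal{K}}v^\top d_t$, $x_{t+1}=x_t+\eta_tv_t$. (Selections are measurable.) The sequence $\rho_t$ is used only for $t\ge2$. Expectations are over all randomness, including the independent uniform choice of the index of $x_o$. *)

(* Defs.v *)
From HB Require Import structures.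
From mathcomp Require Import all_boot all_order all_algebra.
From mathcomp Require Import all_classical all_reals all_analysis.

Set Implicit Arguments.
Unset Strict Implicit.
Unset Printing Implicit Defensive.

Import Order.TTheory GRing.Theory Num.Theory.
Import numFieldNormedType.Exports.

Local Open Scope classical_set_scope.
Local Open Scope ring_scope.

Section Euclidean.
Context {R : realType} {d : nat}.
Implicit Types (u v x y : 'rV[R]_d) (K X : set 'rV[R]_d) (f : 'rV[R]_d -> R).

Definition dotv u v : R := \sum_(i < d) u ord0 i * v ord0 i.

(* The library norm on 'rV[R]_d is the sup norm; it induces the same topology
   and the same notion of differentiability. *)
Definition enorm v : R := Num.sqrt (dotv v v).

Definition grad f x : 'rV[R]_d := \row_(i < d) 'D_(delta_mx ord0 i) f x.

Definition lev x y : Prop := forall i, x ord0 i <= y ord0 i.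

Definition is_argmin K f x : Prop := K x /\ forall y, K y -> f x <= f y.

Definition is_argmax K f x : Prop := K x /\ forall y, K y -> f y <= f x.

Definition box (Xi : 'I_d -> set R) : set 'rV[R]_d :=
  [set x | forall i, Xi i (x ord0 i)].

Definition dr_submodular X f : Prop :=
  (forall x, X x -> 0 <= f x) /\
  (forall x, X x -> differentiable f x) /\
  (forall x y, X x -> X y -> lev x y ->
     forall i, grad f y ord0 i <= grad f x ord0 i).

Definition monotone_on X f : Prop :=
  forall x y, X x -> X y -> lev x y -> f x <= f y.

End Euclidean.

Definition is_max {R : realType} (S : set R) (m : R) : Prop :=
  S m /\ ubound S m.

(* [get] selects the maximum, which exists when K is compact and nonempty. *)
Definition fw_gap {R : realType} {d : nat} (K : set 'rV[R]_d)
    (F : 'rV[R]_d -> R) (x : 'rV[R]_d) : R :=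
  get (is_max [set dotv (v - x) (- grad F x) | v in K]).

Section StochasticFrankWolfe.
Context {R : realType} {d : nat} {dZ dO : measure_display}
  {Z : measurableType dZ} {Omega : measurableType dO}.
Variables (p : probability Z R) (P : probability Omega R).
Variables (K : set 'rV[R]_d) (Ft : 'rV[R]_d -> Z -> R).
Variables (T : nat) (rho eta : nat -> R) (x1 : 'rV[R]_d).
(* Time starts at 1: [g t] is the gradient estimate and [v t] the output of the
   linear oracle at iteration t. *)
Variables (z : nat -> Omega -> Z) (x g v : nat -> Omega -> 'rV[R]_d).

(* The sigma-algebra of what is revealed before iteration t. It contains the
   samples, and also the oracle answers because ties may be broken at random;
   x_1, ..., x_t and g_1, ..., g_(t-1) are functions of these. *)
Definition history (t : nat) : set (set Omega) :=
  <<s \bigcup_(s in [set s | (1 <= s < t)%N])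
        (preimage_set_system setT (z s) measurable `|`
         \bigcup_(i : 'I_d)
           preimage_set_system setT (fun w => v s w ord0 i) measurable) >>.

Record sfw_estimator : Prop := SfwEstimator {
  sfw_z_meas : forall t, (1 <= t <= T)%N -> measurable_fun setT (z t) ;
  sfw_z_law : forall t, (1 <= t <= T)%N ->
    forall A, measurable A -> P (z t @^-1` A) = p A ;
  sfw_z_indep : forall t, (1 <= t <= T)%N ->
    forall H A, history t H -> measurable A ->
      P (H `&` z t @^-1` A) = (P H * P (z t @^-1` A))%E ;
  sfw_v_meas : forall t, (1 <= t <= T)%N ->
    forall i, measurable_fun setT (fun w => v t w ord0 i) ;
  sfw_x_init : forall w, x 1 w = x1 ;
  sfw_g_init : forall w, g 1 w = grad (Ft ^~ (z 1 w)) (x 1 w) ;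
  sfw_g_step : forall t w, (2 <= t <= T)%N ->
    let Delta := grad (Ft ^~ (z t w)) (x t w)
                 - grad (Ft ^~ (z t w)) (x t.-1 w) in
    g t w = (1 - rho t) *: (g t.-1 w + Delta)
            + rho t *: grad (Ft ^~ (z t w)) (x t w) }.

Definition min_update : Prop := forall t w, (1 <= t <= T)%N ->
  is_argmin K (fun u => dotv u (g t w)) (v t w) /\
  x t.+1 w = x t w + eta t *: (v t w - x t w).

Definition dr_max_update : Prop := forall t w, (1 <= t <= T)%N ->
  is_argmax K (fun u => dotv u (g t w)) (v t w) /\
  x t.+1 w = x t w + eta t *: v t w.

(* [history T.+1] is the sigma-algebra of the whole run. *)
Definition uniform_index (iota : Omega -> nat) : Prop :=
  [/\ forall w, (1 <= iota w <= T)%N,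
      measurable_fun setT iota,
      forall t, (1 <= t <= T)%N -> P (iota @^-1` [set t]) = (T%:R^-1)%:E &
      forall t H, (1 <= t <= T)%N -> history T.+1 H ->
        P (H `&` iota @^-1` [set t]) = (P H * P (iota @^-1` [set t]))%E].

End StochasticFrankWolfe.

(* Main.v *)
From HB Require Import structures.
Require Import Defs.
From mathcomp Require Import all_boot all_order all_algebra.
From mathcomp Require Import all_classical all_reals all_analysis.
From mathcomp Require Import measurable_realfun zify ring lra.

Set Implicit Arguments.
Unset Strict Implicit.
Unset Printing Implicit Defensive.

Import Order.TTheory GRing.Theory Num.Theory.
Import numFieldNormedType.Exports.

Local Open Scope classical_set_scope.
Local Open Scope ring_scope.

(** Let e_t = g_t - grad F (x_t) be the error of the gradient estimate. The proof has
    one probabilistic part, a bound on the mean square of e_t, and one deterministic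
    part, the analysis of a Frank-Wolfe step taken with an inexact gradient.

    Error. The correction term of the estimator makes e_t equal to (1 - rho_t) e_(t-1)
    plus a combination of the noises grad Ft(.; z_t) - grad F at x_t and x_(t-1)
    ([err_step]). Since z_t is independent of the past and the noise has mean zero at
    every fixed point, this combination is orthogonal to e_(t-1) in mean
    ([mean_dotv_noise]). It is a difference of noises at two consecutive iterates plus
    rho_t times a noise; the step sizes being at most rho_t, its norm is at most C rho_t,
    where C = 2 L M + 2 G and M bounds the motion of the iterates. Hence
      E |e_t|^2 <= (1 - rho_t)^2 E |e_(t-1)|^2 + C^2 rho_t^2,
    and since (1 - rho_t) rho_(t-1) <= rho_t, induction gives E |e_t|^2 <= C^2 rho_t
    ([mean_sq_err_le]).

    Measurability. Orthogonality is Fubini's theorem on the product of the past and the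
    sample space ([mean_indep]), which needs grad Ft(x; z) to be jointly measurable in
    (x, z). It is, because it is measurable in z and Lipschitz in x on K
    ([measurable_lipschitz]); the same lemma makes F and the Frank-Wolfe gap of the
    iterates measurable.

    Steps. The linear oracle is called at g_t instead of grad F (x_t), which costs at
    most D |e_t|. The inequality |e| <= (|e|^2 / r + r) / 2 at r = sqrt(rho_t) makes this
    cost linear in |e_t|^2, and its mean O(sqrt(rho_t)); its sum over T iterations is
    O(T^(1/2)) for rho_t = 1/(t-1) and O(T^(2/3)) for rho_t = (t-1)^(-2/3)
    ([mean_sum_excess_le]). What is left is the usual argument in each case. For convex
    F, t (F x_(t+1) - F xstar) telescopes ([convex_rate]). For non-convex F, the gaps sum
    to at most 2 B / eta up to errors, and the random index averages them
    ([nonconvex_rate]). For DR-submodular F, the inequality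
    <grad F (x), y> >= F y - F x ([submodular_first_order]) contracts the suboptimality
    by 1 - 1/T at each step ([submodular_rate]). All inequalities hold for every
    outcome, and the mean is taken once at the end. *)

(** Only the inequalities between natural numbers reach [lia]; otherwise its
    certificates would mention the real-valued hypotheses of the enclosing section,
    and every lemma would come out depending on them. *)
Ltac nat_lia :=
  repeat match goal with
  | H : ?A |- _ => lazymatch A with
    | is_true (leq _ _) => fail
    | is_true (leq _ _ && _) => fail
    | is_true (_ || _) => fail
    | _ => clear H
    end
  end; lia.

(** * Euclidean geometry and gradients *)

Section Euclid.
Context {R : realType} {d : nat}.
Implicit Types (u v x y : 'rV[R]_d) (f : 'rV[R]_d -> R).

Lemma dotvC u v : dotv u v = dotv v u.
Proof. by apply: eq_bigr => i _; rewrite mulrC. Qed.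

Lemma dotvDl u v w : dotv (u + v) w = dotv u w + dotv v w.
Proof. by rewrite -big_split; apply: eq_bigr => i _; rewrite mxE mulrDl. Qed.

Lemma dotvZl (a : R) u v : dotv (a *: u) v = a * dotv u v.
Proof. by rewrite mulr_sumr; apply: eq_bigr => i _; rewrite mxE mulrA. Qed.

Lemma dotvNl u v : dotv (- u) v = - dotv u v.
Proof. by rewrite -scaleN1r dotvZl mulN1r. Qed.

Lemma dotvBl u v w : dotv (u - v) w = dotv u w - dotv v w.
Proof. by rewrite dotvDl dotvNl. Qed.

Lemma dotvDr u v w : dotv u (v + w) = dotv u v + dotv u w.
Proof. by rewrite dotvC dotvDl !(dotvC u). Qed.

Lemma dotvZr (a : R) u v : dotv u (a *: v) = a * dotv u v.
Proof. by rewrite dotvC dotvZl dotvC. Qed.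

Lemma dotvNr u v : dotv u (- v) = - dotv u v.
Proof. by rewrite dotvC dotvNl dotvC. Qed.

Lemma dotvBr u v w : dotv u (v - w) = dotv u v - dotv u w.
Proof. by rewrite dotvDr dotvNr. Qed.

Definition dotvE := (dotvDl, dotvDr, dotvNl, dotvNr, dotvZl, dotvZr).

Lemma dotv_sqrD (a : R) u v : dotv (a *: u + v) (a *: u + v) =
  a ^+ 2 * dotv u u + 2 * a * dotv u v + dotv v v.
Proof. by rewrite !dotvE (dotvC v u); ring. Qed.

Lemma dotv_ge0 v : 0 <= dotv v v.
Proof. by apply: sumr_ge0 => i _; rewrite -expr2 sqr_ge0. Qed.

Lemma enorm_ge0 v : 0 <= enorm v.
Proof. exact: sqrtr_ge0. Qed.

Lemma sqr_enorm v : enorm v ^+ 2 = dotv v v.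
Proof. by rewrite sqr_sqrtr// dotv_ge0. Qed.

Lemma normr_coord_le_enorm v i : `|v ord0 i| <= enorm v.
Proof.
rewrite -sqrtr_sqr ler_sqrt ?dotv_ge0// /dotv (bigD1 i)//= expr2 lerDl.
by apply: sumr_ge0 => j _; rewrite -expr2 sqr_ge0.
Qed.

Lemma normr_coordB_le u v i : `|u ord0 i - v ord0 i| <= enorm (u - v).
Proof.
rewrite (_ : u ord0 i - v ord0 i = (u - v) ord0 i) ?normr_coord_le_enorm//.
by rewrite !mxE.
Qed.

Lemma enorm_eq0 v : enorm v = 0 -> v = 0.
Proof.
move=> v0; apply/rowP => i; rewrite mxE; apply/eqP; rewrite -normr_le0 -v0.
exact: normr_coord_le_enorm.
Qed.

Lemma cauchy_schwarz u v : dotv u v <= enorm u * enorm v.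
Proof.
(* Away from the degenerate cases, expand | |v| u - |u| v |^2 >= 0. *)
have [u0|u0] := eqVneq (enorm u) 0.
  by rewrite u0 mul0r (enorm_eq0 u0) -(scale0r 0) dotvZl mul0r.
have [v0|v0] := eqVneq (enorm v) 0.
  by rewrite v0 mulr0 (enorm_eq0 v0) -(scale0r 0) dotvZr mul0r.
have uv0 : 0 < enorm u * enorm v by rewrite mulr_gt0// lt0r ?u0 ?v0 enorm_ge0.
have := dotv_ge0 (enorm v *: u - enorm u *: v).
rewrite !dotvE (dotvC v u) -!sqr_enorm => h.
rewrite -(ler_pM2l uv0); nra.
Qed.

Lemma normr_dotv_le u v : `|dotv u v| <= enorm u * enorm v.
Proof.
rewrite ler_norml cauchy_schwarz andbT lerNl -dotvNl.
apply: le_trans (cauchy_schwarz _ _) _; rewrite le_eqVlt; apply/orP; left.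
by apply/eqP; congr (_ * _); rewrite /enorm dotvNl dotvNr opprK.
Qed.

Lemma enormN v : enorm (- v) = enorm v.
Proof. by rewrite /enorm dotvNl dotvNr opprK. Qed.

Lemma enormB u v : enorm (u - v) = enorm (v - u).
Proof. by rewrite -enormN opprB. Qed.

Lemma enormZ (a : R) v : enorm (a *: v) = `|a| * enorm v.
Proof.
by rewrite /enorm dotvZl dotvZr mulrA -expr2 sqrtrM ?sqr_ge0// sqrtr_sqr.
Qed.

Lemma enormD u v : enorm (u + v) <= enorm u + enorm v.
Proof.
rewrite -(@ler_pXn2r _ 2) ?nnegrE ?addr_ge0 ?enorm_ge0//.
rewrite sqr_enorm !dotvE (dotvC v u) sqrrD !sqr_enorm.
have := cauchy_schwarz u v; lra.
Qed.

Lemma enorm_le_sum v : enorm v <= \sum_i `|v ord0 i|.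
Proof.
rewrite -(@ler_pXn2r _ 2) ?nnegrE ?enorm_ge0 ?sumr_ge0// sqr_enorm /dotv expr2.
rewrite mulr_suml; apply: ler_sum => i _.
apply: le_trans (ler_norm _) _; rewrite normrM ler_wpM2l//.
by rewrite (bigD1 i)//= lerDl sumr_ge0.
Qed.

(** Links the coordinatewise [grad] to the Frechet differential: the partial
    derivatives of a differentiable function determine it by linearity. *)
Lemma dotv_grad f x u : differentiable f x -> 'd f x u = dotv (grad f x) u.
Proof.
move=> df; rewrite {1}[u]row_sum_delta linear_sum/=; apply: eq_bigr => i _.
by rewrite linearZ/= -deriveE// mxE [RHS]mulrC.
Qed.

Lemma is_derive_line f x u (s : R) : differentiable f (x + s *: u) ->
  is_derive s 1 (fun s => f (x + s *: u)) (dotv (grad f (x + s *: u)) u).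
Proof.
move=> df.
(* The difference quotient of the restriction to the line is the one that defines
   the directional derivative of f along u. *)
have E : (fun h : R => h^-1 *: (f (x + (h *: 1 + s) *: u) - f (x + s *: u))) =
         (fun h => h^-1 *: (f (h *: u + (x + s *: u)) - f (x + s *: u))).
  apply/funext => h; congr (_ *: (f _ - _)).
  by rewrite [h *: 1]mulr1 scalerDl addrCA.
split; rewrite /derivable /derive /= E; first exact: diff_derivable.
by rewrite -dotv_grad// -deriveE.
Qed.

Lemma mvt_segment f x u : (forall s : R, 0 <= s <= 1 -> differentiable f (x + s *: u)) ->
  exists2 s : R, 0 <= s <= 1 & f (x + u) - f x = dotv (grad f (x + s *: u)) u.
Proof.
move=> df.
have dl (s : R) : s \in `]0, 1[%R ->
    is_derive s 1 (fun s => f (x + s *: u)) (dotv (grad f (x + s *: u)) u).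
  rewrite in_itv/= => /andP[s0 s1]; apply: is_derive_line; apply: df.
  by rewrite !ltW.
have [|s s01] := MVT ltr01 dl.
  apply: derivable_within_continuous => s; rewrite in_itv/= => s01.
  by have [] := is_derive_line (df _ s01).
rewrite scale1r scale0r addr0 subr0 mulr1 => ->; exists s => //.
by move: s01; rewrite in_itv/= => /andP[s0 s1]; rewrite !ltW.
Qed.

(** Gives both the first-order inequality of a convex function and the sign of the
    derivatives of a monotone one. It looks at one side of x only, because the
    segment starting at x need not extend beyond x inside the domain. *)
Lemma dotv_grad_le f x u (b : R) : differentiable f x ->
  (forall s : R, 0 < s <= 1 -> f (x + s *: u) <= f x + s * b) ->
  dotv (grad f x) u <= b.
Proof.
move=> df fb; rewrite -dotv_grad// -deriveE//.
have /cvg_dnbhs_at_right dl : derivable f x u by exact: diff_derivable.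
apply: (cvgr_to_le dl); near=> h.
have h0 : 0 < h by near: h; exact: nbhs_right_gt.
rewrite /= [_ *: _]mulrC ler_pdivrMr// mulrC lerBlDl [h *: u + x]addrC.
apply: fb; rewrite h0/=; near: h; exact: nbhs_right_le.
Unshelve. all: by end_near. Qed.

End Euclid.

(** * Measurability of Lipschitz functions of a random point *)

Section CountableDense.
Context {R : realType} {d : nat}.
Implicit Types (K : set 'rV[R]_d) (x y q : 'rV[R]_d).

(** An arbitrary set of vectors is separable. The index (r, n) selects a point of K
    whose distance to the rational vector r is below 1/(n+1) in each coordinate, when
    there is one; [x0] fills the other indices, so that the sequence stays in K. *)
Lemma countable_dense K x0 : K x0 ->
  exists q : 'rV[rat]_d * nat -> 'rV[R]_d, (forall c, K (q c)) /\
    forall x e, K x -> 0 < e -> exists c, enorm (x - q c) < e.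
Proof.
move=> Kx0.
pose near_c (c : 'rV[rat]_d * nat) (y : 'rV[R]_d) :=
  forall i, `|y ord0 i - ratr (c.1 ord0 i)| < (c.2.+1%:R)^-1.
have /choice[q qP] c : exists y, K y /\
    ((exists y', K y' /\ near_c c y') -> near_c c y).
  have [[y' [Ky' ny']]|ny] := pselect (exists y', K y' /\ near_c c y').
    by exists y'.
  by exists x0.
exists q; split=> [c|x e Kx e0]; first by have [] := qP c.
have [n ne] : exists n : nat, 2 * d%:R / e < n.+1%:R.
  exists (Num.trunc (2 * d%:R / e)).
  by rewrite truncnS_gt// ?divr_ge0// ?mulr_ge0// ltW.
have n0 : 0 < n.+1%:R^-1 :> R by rewrite invr_gt0 ltr0n.
have /fin_all_exists[r rP] i :
    exists r : rat, `|x ord0 i - ratr r| < n.+1%:R^-1.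
  have [|r] := @rat_in_itvoo R (x ord0 i) (x ord0 i + n.+1%:R^-1).
    by rewrite ltrDl.
  rewrite in_itv/= => /andP[r1 r2]; exists r.
  by rewrite distrC gtr0_norm ?subr_gt0// ltrBlDl.
pose c := (\row_i r i, n); exists c.
have nx : near_c c x by move=> i; rewrite /= mxE.
have nq : near_c c (q c) by have [_] := qP c; apply; exists x.
apply: (@le_lt_trans _ _ (\sum_(i < d) (2 * n.+1%:R^-1))).
  apply: le_trans (enorm_le_sum _) _; apply: ler_sum => i _.
  rewrite !mxE (_ : 2 * _ = n.+1%:R^-1 + n.+1%:R^-1); last by ring.
  apply: le_trans (ler_distD (ratr (c.1 ord0 i)) _ _) _.
  by rewrite lerD// ltW// distrC; apply: nq.
rewrite sumr_const card_ord -[_ *+ d]mulr_natr mulrAC ltr_pdivrMr ?ltr0n//.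
by move: ne; rewrite ltr_pdivrMr// [n.+1%:R * e]mulrC.
Qed.

End CountableDense.

Section Measurability.
Context {R : realType} {d : nat} {dO : measure_display}
  {Omega : measurableType dO}.
Implicit Types (K : set 'rV[R]_d) (X Y : Omega -> 'rV[R]_d).

Definition coord_measurable X :=
  forall i, measurable_fun setT (fun w => X w ord0 i).

Lemma measurable_dotv X Y : coord_measurable X -> coord_measurable Y ->
  measurable_fun setT (fun w => dotv (X w) (Y w)).
Proof. by move=> mX mY; apply: measurable_sum => i; exact: measurable_funM. Qed.

Lemma measurable_enorm X : coord_measurable X ->
  measurable_fun setT (fun w => enorm (X w)).
Proof.
move=> mX; apply: (measurableT_comp (f := @Num.sqrt R)).
  by apply: continuous_measurable_fun; exact: sqrt_continuous.
exact: measurable_dotv.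
Qed.

Lemma coord_measurableB X Y : coord_measurable X -> coord_measurable Y ->
  coord_measurable (fun w => X w - Y w).
Proof.
move=> mX mY i; rewrite (_ : (fun w => _) = fun w => X w ord0 i - Y w ord0 i).
  exact: measurable_funB.
by apply/funext => w; rewrite !mxE.
Qed.

Lemma coord_measurable_lin (a b : R) X Y : coord_measurable X ->
  coord_measurable Y -> coord_measurable (fun w => a *: X w + b *: Y w).
Proof.
move=> mX mY i.
rewrite (_ : (fun w => _) = fun w => a * X w ord0 i + b * Y w ord0 i).
  by apply: measurable_funD; apply: measurable_funM.
by apply/funext => w; rewrite !mxE.
Qed.

(** A function that is measurable in the sample and Lipschitz in the point is jointly
    measurable. By the Lipschitz bound, H x w is the infimum of
    H q w + |M| enorm (x - q) over a countable dense set of q, so each set where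
    H (X w) w < a is a countable union of measurable sets. *)
Lemma measurable_lipschitz K (H : 'rV[R]_d -> Omega -> R) X M :
  (forall x, K x -> measurable_fun setT (H x)) ->
  (forall x y w, K x -> K y -> `|H x w - H y w| <= M * enorm (x - y)) ->
  (forall w, K (X w)) -> coord_measurable X ->
  measurable_fun setT (fun w => H (X w) w).
Proof.
move=> mH lipH KX mX.
have [q [Kq dq]] := countable_dense (KX point).
have lipH' x y w : K x -> K y -> `|H x w - H y w| <= `|M| * enorm (x - y).
  move=> Kx Ky; apply: le_trans (lipH _ _ _ Kx Ky) _.
  by rewrite ler_wpM2r ?enorm_ge0// ler_norm.
apply: (measurability _ (RGenInftyO.measurableE R)) => _ [_ [a ->] <-].
rewrite setTI [X in measurable X](_ : _ = \bigcup_c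
   [set w | H (q c) w + `|M| * enorm (X w - q c) < a]).
  apply: countable_bigcupT_measurable => // c.
  have mc : measurable_fun setT
      (fun w => H (q c) w + `|M| * enorm (X w - q c)).
    apply: measurable_funD; first exact: mH.
    apply: measurable_funM => //; apply: measurable_enorm.
    by apply: coord_measurableB => // i; exact: measurable_cst.
  rewrite -[X in measurable X]setTI.
  rewrite (_ : [set w | _] = (fun w => H (q c) w + `|M| * enorm (X w - q c)) @^-1`
    `]-oo, a[%classic); first exact: mc.
  by apply/seteqP; split=> w /=; rewrite in_itv.
apply/seteqP; split=> w /=; rewrite in_itv/=.
  (* q is so close to X w that the excess of the bound over H (X w) w, at most
     2 |M| enorm (X w - q), stays below the gap up to a. *)
  move=> Ha; pose e := (a - H (X w) w) / (2 * `|M| + 1).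
  have M0 : 0 < 2 * `|M| + 1 by rewrite ltr_wpDl// mulr_ge0.
  have e0 : 0 < e by rewrite divr_gt0// subr_gt0.
  have [c ce] := dq _ _ (KX w) e0; exists c => //=.
  move: ce; rewrite ltr_pdivlMr// => ce.
  have := lipH' _ _ w (KX w) (Kq c); rewrite ler_norml => /andP[h _].
  have := enorm_ge0 (X w - q c); nra.
move=> [c _ /=]; apply: le_lt_trans.
have := lipH' _ _ w (KX w) (Kq c); rewrite ler_norml => /andP[_ h].
by rewrite -lerBlDl.
Qed.

End Measurability.

(** * Means of bounded functions and independence *)

Section Mean.
Context {R : realType} {dO : measure_display} {Omega : measurableType dO}.
Variable P : probability Omega R.
Implicit Types f g : Omega -> R.

(** Every random variable of the proof is bounded; this class is integrable and closed
    under the algebraic operations, which spares integrability side conditions. *)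
Definition bounded_measurable f :=
  measurable_fun setT f /\ exists M, forall w, `|f w| <= M.

Lemma bm_integrable f : bounded_measurable f -> P.-integrable setT (EFin \o f).
Proof.
move=> [mf [M fM]]; apply: measurable_bounded_integrable => //.
  by rewrite (le_lt_trans (probability_le1 _ _)) ?ltry.
exists M; split; first exact: num_real.
by move=> x Mx w _ /=; exact: le_trans (fM w) (ltW Mx).
Qed.

Lemma bm_cst (a : R) : bounded_measurable (fun=> a).
Proof. by split => //; exists `|a|. Qed.

Lemma bmD f g : bounded_measurable f -> bounded_measurable g ->
  bounded_measurable (fun w => f w + g w).
Proof.
move=> [mf [M fM]] [mg [N gN]]; split; first exact: measurable_funD.
by exists (M + N) => w; apply: le_trans (ler_normD _ _) _; exact: lerD.
Qed.

Lemma bmM f g : bounded_measurable f -> bounded_measurable g ->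
  bounded_measurable (fun w => f w * g w).
Proof.
move=> [mf [M fM]] [mg [N gN]]; split; first exact: measurable_funM.
by exists (M * N) => w; rewrite normrM ler_pM.
Qed.

Lemma bmZ (a : R) f : bounded_measurable f -> bounded_measurable (fun w => a * f w).
Proof. exact: bmM (bm_cst a). Qed.

Lemma bm_sum I (s : seq I) (F : I -> Omega -> R) :
  (forall i, bounded_measurable (F i)) ->
  bounded_measurable (fun w => \sum_(i <- s) F i w).
Proof.
move=> bF; elim: s => [|i s IH].
  by under eq_fun do rewrite big_nil; exact: bm_cst.
by under eq_fun do rewrite big_cons; exact: bmD.
Qed.

Lemma mean_cst (a : R) : \int[P]_w a = a.
Proof.
rewrite Rintegral_cst// -[RHS]mulr1; congr (_ * _).
exact: (congr1 fine (probability_setT P)).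
Qed.

Lemma meanD f g : bounded_measurable f -> bounded_measurable g ->
  \int[P]_w (f w + g w) = \int[P]_w f w + \int[P]_w g w.
Proof. by move=> bf bg; rewrite RintegralD//; exact: bm_integrable. Qed.

Lemma meanZ (a : R) f : bounded_measurable f ->
  \int[P]_w (a * f w) = a * \int[P]_w f w.
Proof. by move=> bf; rewrite RintegralZl//; exact: bm_integrable. Qed.

Lemma mean_sum I (s : seq I) (F : I -> Omega -> R) :
  (forall i, bounded_measurable (F i)) ->
  \int[P]_w (\sum_(i <- s) F i w) = \sum_(i <- s) \int[P]_w F i w.
Proof.
move=> bF; elim: s => [|i s IH].
  by under eq_Rintegral do rewrite big_nil; rewrite big_nil mean_cst.
under eq_Rintegral do rewrite big_cons.
by rewrite big_cons meanD// ?IH//; exact: bm_sum.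
Qed.

Lemma mean_le f g : bounded_measurable f -> bounded_measurable g ->
  (forall w, f w <= g w) -> \int[P]_w f w <= \int[P]_w g w.
Proof. by move=> bf bg fg; apply: le_Rintegral => //; exact: bm_integrable. Qed.

Lemma normr_mean_le f M : measurable_fun setT f -> (forall w, `|f w| <= M) ->
  `|\int[P]_w f w| <= M.
Proof.
move=> mf fM; have bf : bounded_measurable f by split => //; exists M.
rewrite ler_norml -[X in X <= _ <= _]mean_cst -[X in _ <= _ <= X]mean_cst.
by rewrite !mean_le//; try exact: bm_cst; move=> w; move: (fM w);
  rewrite ler_norml => /andP[].
Qed.

(** The shape of the error recursion: the terms [f0] and [f1] vanish on average. *)
Lemma mean_le_affine f' f f0 f1 (q a0 a1 c : R) :
  bounded_measurable f' -> bounded_measurable f ->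
  bounded_measurable f0 -> bounded_measurable f1 ->
  \int[P]_w f0 w = 0 -> \int[P]_w f1 w = 0 ->
  (forall w, f' w <= q * f w + (a0 * f0 w + a1 * f1 w) + c) ->
  \int[P]_w f' w <= q * \int[P]_w f w + c.
Proof.
move=> bf' bf b0 b1 m0 m1 h.
have bZ := bmZ q bf; have bI := bmD (bmZ a0 b0) (bmZ a1 b1).
have bL := bmD bZ bI; have bc := bm_cst c.
apply: le_trans (mean_le bf' (bmD bL bc) h) _.
rewrite (meanD bL bc) (meanD bZ bI) (meanD (bmZ a0 b0) (bmZ a1 b1)).
by rewrite mean_cst !meanZ// m0 m1 !mulr0 !addr0.
Qed.

Lemma expectationE f : bounded_measurable f ->
  ('E_P[f] = (\int[P]_w f w)%:E)%E.
Proof.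
by move=> bf; rewrite unlock fineK//; exact/integrable_fin_num/bm_integrable.
Qed.

End Mean.

Section Independence.
Context {R : realType} {dZ dO : measure_display}
  {Z : measurableType dZ} {Omega : measurableType dO}.
Variables (p : probability Z R) (P : probability Omega R).
Variables (G : set (set Omega)) (zeta : Omega -> Z).
Let OmegaG : measurableType _ := g_sigma_algebraType G.
Hypotheses (G_meas : <<s G >> `<=` measurable)
  (zeta_meas : measurable_fun setT zeta)
  (zeta_indep : forall H A, <<s G >> H -> measurable A ->
     P (H `&` zeta @^-1` A) = (P H * p A)%E).

(** A sample independent of the past can be averaged out while the past is frozen. The
    pair (w, zeta w) has the product law, since the two agree on rectangles, so this
    is Fubini's theorem on (Omega, sigma(G)) x Z. *)
Lemma mean_indep (f : OmegaG * Z -> R) : bounded_measurable f ->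
  \int[P]_w f (w, zeta w) = \int[P]_w \int[p]_z f (w, z).
Proof.
move=> [mf [M fM]].
have mid : measurable_fun setT (idfun : Omega -> OmegaG).
  by move=> _ A mA; rewrite setTI; exact: G_meas.
pose idm : {mfun Omega >-> OmegaG} := HB.pack (idfun : Omega -> OmegaG)
  (isMeasurableFun.Build _ _ _ _ _ mid).
pose PG : probability OmegaG R := distribution P idm.
pose phi : Omega -> OmegaG * Z := fun w => (w, zeta w).
have mphi : measurable_fun setT phi by exact: measurable_fun_pair.
pose phim : {mfun Omega >-> _} := HB.pack phi
  (isMeasurableFun.Build _ _ _ _ _ mphi).
have mF : measurable_fun setT (EFin \o f) by exact/measurable_EFinP.
have law X : measurable X -> (PG \x p)%E X = distribution P phim X.
  apply: product_measure_unique => A B mA mB.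
  by rewrite /distribution/= /pushforward/=; exact: zeta_indep.
have intF : (PG \x p)%E.-integrable setT (EFin \o f).
  apply: measurable_bounded_integrable => //.
    apply: le_lt_trans (ltry 1).
    apply: le_trans (probability_le1 (distribution P phim) measurableT).
    by rewrite le_eqVlt; apply/orP; left; apply/eqP; exact: law.
  exists M; split; first exact: num_real.
  by move=> x Mx w _ /=; exact: le_trans (fM w) (ltW Mx).
have bw w : bounded_measurable (fun z => f (w, z)).
  by split; [exact: measurableT_comp|exists M].
have sectE w : (\int[p]_z (f (w, z))%:E)%E = (\int[p]_z f (w, z))%:E.
  by rewrite fineK//; exact/integrable_fin_num/(bm_integrable p (bw w)).
rewrite /Rintegral; congr fine.
transitivity (\int[distribution P phim]_y (EFin \o f) y)%E.
  rewrite /distribution (integral_pushforward mphi mF)//.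
  apply: (@bm_integrable _ _ _ P (f \o phi)).
  by split; [exact: measurableT_comp|exists M => w; exact: fM].
transitivity (\int[PG \x p]_y (EFin \o f) y)%E.
  by apply: eq_measure_integral => A mA _; exact/esym/law.
have mM w : `|\int[p]_z f (w, z)| <= M.
  by apply: normr_mean_le; [case: (bw w)|move=> z; exact: fM].
have mmean : measurable_fun setT (fun w : OmegaG => \int[p]_z f (w, z)).
  apply/measurable_EFinP.
  rewrite [X in measurable_fun _ X](_ : _ = fubini_F p (EFin \o f)).
    exact: measurable_fubini_F intF.
  by apply/funext => w; rewrite /fubini_F/= sectE.
rewrite -integral12_prod_meas1//.
rewrite (_ : fubini_F p (EFin \o f) = fun w => (\int[p]_z f (w, z))%:E); last first.
  by apply/funext => w; rewrite /fubini_F/= sectE.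
rewrite /distribution (integral_pushforward mid)//; first exact/measurable_EFinP.
apply: (@bm_integrable _ _ _ P (fun w => \int[p]_z f (w, z))); split.
  exact: (measurableT_comp mmean mid).
by exists M.
Qed.

End Independence.

Section BoolIndependence.
Context {R : realType} {dO : measure_display} {Omega : measurableType dO}.
Variables (P : probability Omega R) (H : set (set Omega)).
Variables (c : Omega -> bool) (q : R).
Let OmegaH : measurableType _ := g_sigma_algebraType H.
Hypotheses (H_meas : <<s H >> `<=` measurable)
  (c_meas : measurable_fun setT c)
  (c_prob : P (c @^-1` [set true]) = q%:E)
  (c_indep : forall A, <<s H >> A ->
     (P (A `&` c @^-1` [set true]) = P A * P (c @^-1` [set true]))%E).

(** Independence of a single event suffices: the four measurable sets of booleans are
    checked one by one, which reduces the claim to [mean_indep]. *)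
Lemma mean_indicator (U : OmegaH -> R) : bounded_measurable U ->
  \int[P]_w (U w * (c w)%:R) = q * \int[P]_w U w.
Proof.
move=> [mU [M UM]].
pose cm : {mfun Omega >-> bool} := HB.pack c
  (isMeasurableFun.Build _ _ _ _ _ c_meas).
pose law : probability bool R := distribution P cm.
pose Ev := c @^-1` [set true].
have mEv : measurable Ev by rewrite -[Ev]setTI; exact: c_meas.
have indep A B : <<s H >> A -> measurable B ->
    (P (A `&` c @^-1` B) = P A * P (c @^-1` B))%E.
  move=> hA _; have mA := H_meas hA.
  have [a ea] : exists a, P A = a%:E.
    by exists (fine (P A)); rewrite fineK// fin_num_measure.
  have eEv : P Ev = q%:E by [].
  have eI : P (A `&` Ev) = (a * q)%:E by rewrite c_indep// ea eEv EFinM.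
  have [tB|tB] := pselect (B true); have [fB|fB] := pselect (B false).
  - have -> : c @^-1` B = setT.
      by apply/seteqP; split=> w //= _; case: (c w).
    by rewrite setIT probability_setT mule1.
  - have -> : c @^-1` B = Ev.
      by apply/seteqP; split=> w; rewrite /Ev /=; case: (c w).
    exact: c_indep.
  - have -> : c @^-1` B = ~` Ev.
      by apply/seteqP; split=> w; rewrite /Ev /=; case: (c w).
    have -> : P (A `&` ~` Ev) = (a%:E - (a * q)%:E)%E.
      rewrite -setDE -ea -eI; apply: measureD => //.
      exact: le_lt_trans (probability_le1 P mA) (ltry 1).
    by rewrite probability_setC// eEv ea -!EFinB -EFinM mulrBr mulr1.
  - have -> : c @^-1` B = set0.
      by apply/seteqP; split=> w //=; case: (c w).
    by rewrite setI0 measure0 mule0.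
pose f (u : OmegaH * bool) := U u.1 * u.2%:R.
have bb : bounded_measurable (fun b : bool => b%:R : R).
  by split; [done|exists 1 => -[]; rewrite ?normr1 ?normr0].
have bf : bounded_measurable f.
  apply: bmM; split; first exact: (measurableT_comp mU measurable_fst).
  - by exists M => u; exact: UM.
  - exact: (measurableT_comp (proj1 bb) measurable_snd).
  - by exists 1 => -[u []]; rewrite /= ?normr1 ?normr0.
rewrite [LHS](mean_indep (p := law) H_meas c_meas indep bf).
have b1 : \int[law]_b (b%:R : R) = q.
  rewrite /Rintegral (_ : (fun b : bool => (b%:R)%:E) = EFin \o \1_[set true]).
    rewrite integral_indic// setIT; exact: (congr1 fine c_prob).
  by apply/funext => b; rewrite /= indicE; case: b; [rewrite mem_set|rewrite memNset].
rewrite mulrC -RintegralZr//.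
  by apply: eq_Rintegral => w _; rewrite /f/= meanZ// b1.
apply: bm_integrable; split; last by exists M.
by move=> _ A mA; apply: H_meas; exact: (mU measurableT A mA).
Qed.

End BoolIndependence.

(** * Powers of the iteration count *)

Section Rates.
Context {R : realType}.
Implicit Types (b : R) (t n : nat).

(** Compares n^(-b) with the increments of its discrete primitive n^(1-b) / (1-b). It
    is the weighted inequality n^(1-b) (n+1)^b <= (1-b) n + b (n+1) between geometric
    and arithmetic means. *)
Lemma powR_increment b n : 0 <= b <= 1 / 2 -> (1 <= n)%N ->
  (1 - b) * n.+1%:R `^ (- b) <= n.+1%:R `^ (1 - b) - n%:R `^ (1 - b) :> R.
Proof.
move=> /andP[b0 b2] n1.
have [->|bn0] := eqVneq b 0.
  by rewrite oppr0 addr0 powRr0 !powRr1// -natr1; lra.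
have b0' : 0 < b by rewrite lt0r bn0.
have n0 : 0 < n%:R :> R by rewrite ltr0n.
have h : n%:R `^ (1 - b) * n.+1%:R `^ b <= n%:R * (1 - b) + n.+1%:R * b.
  have := @conjugate_powR R (n%:R `^ (1 - b)) (n.+1%:R `^ b) (1 - b)^-1 b^-1.
  rewrite -!powRrM !divff ?subr_eq0//; last by lra.
  rewrite !powRr1 ?invrK//; apply; rewrite ?powR_ge0 ?invr_gt0//; lra.
have a0 : 0 < n.+1%:R `^ (- b) :> R by rewrite powR_gt0.
have e1 : n.+1%:R `^ (1 - b) = n.+1%:R * n.+1%:R `^ (- b) :> R.
  by rewrite powRD ?powRr1//; apply/implyP => _; rewrite pnatr_eq0.
have e2 : n.+1%:R `^ b * n.+1%:R `^ (- b) = 1 :> R.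
  by rewrite -powRD ?subrr ?powRr0//; apply/implyP => _; rewrite pnatr_eq0.
have : n%:R `^ (1 - b) * (n.+1%:R `^ b * n.+1%:R `^ (- b)) <=
   (n%:R * (1 - b) + n.+1%:R * b) * n.+1%:R `^ (- b).
  by rewrite mulrA ler_wpM2r// ltW.
rewrite e2 e1 mulr1 -natr1; lra.
Qed.

(** The weights 1, 1, 2^(-b), 3^(-b), ... of the iterations t = 1, 2, 3, 4, ...: for
    t >= 2 the parameter rho_t has the form (t-1)^(-b), and [maxn] extends it to t = 1. *)
Definition rate b t : R := (maxn t.-1 1)%:R `^ (- b).

Lemma rate_gt0 b t : 0 < rate b t.
Proof. by rewrite powR_gt0// ltr0n; lia. Qed.

Lemma rate1 b : rate b 1 = 1.
Proof. by rewrite /rate powR1. Qed.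

Lemma rateE b t : (2 <= t)%N -> rate b t = t.-1%:R `^ (- b).
Proof. by move=> t2; rewrite /rate (_ : maxn _ _ = t.-1)//; lia. Qed.

Lemma sqr_rate b t : rate b t ^+ 2 = rate (2 * b) t.
Proof.
rewrite expr2 -powRD; first by congr (_ `^ _); ring.
by apply/implyP => _; rewrite pnatr_eq0; lia.
Qed.

Lemma rate01 b t : 0 <= b -> 0 <= rate b t <= 1.
Proof.
move=> b0; rewrite ltW ?rate_gt0//= -[leRHS](powRr0 (maxn t.-1 1)%:R).
by rewrite ler_powR ?oppr_le0// ler1n; lia.
Qed.

(** A sequence contracted by 1 - rho_t thus keeps a bound proportional to rho_t. For
    t >= 2 write n = t - 1 and m = t: then 1 - m^(-b) <= 1 - 1/m = n/m <= (n/m)^b, and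
    (n/m)^b n^(-b) = m^(-b). *)
Lemma rate_contraction b t : 0 <= b <= 1 -> (1 <= t)%N ->
  (1 - rate b t.+1) * rate b t <= rate b t.+1.
Proof.
move=> /andP[b0 b1]; case: t => // -[_|t _].
  by rewrite [rate b 2](_ : _ = 1) ?subrr ?mul0r// /rate powR1.
rewrite !rateE//=; set n := t.+1%:R; set m := t.+2%:R.
have n0 : 0 < n :> R by rewrite ltr0n.
have m0 : 0 < m :> R by rewrite ltr0n.
have h1 : m^-1 <= m `^ (- b) :> R.
  rewrite -powR_inv1 ?(ltW m0)// ler_powR ?lerN2//.
  by rewrite /m ler1n.
have h2 : n / m <= (n / m) `^ b.
  rewrite -[leLHS]powRr1 ?divr_ge0 ?(ltW m0) ?(ltW n0)//.
  apply: ger_powR => //; rewrite divr_gt0//= ler_pdivrMr// mul1r ler_nat; lia.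
have h3 : (n / m) `^ b * n `^ (- b) = m `^ (- b).
  rewrite powRM ?(ltW n0) ?invr_ge0 ?(ltW m0)// -powR_inv1 ?(ltW m0)//.
  rewrite -powRrM mulN1r mulrAC -powRD ?subrr ?powRr0 ?mul1r//.
  by apply/implyP => _; rewrite gt_eqF.
rewrite -[leRHS]h3 ler_wpM2r ?powR_ge0//; apply: le_trans h2.
have -> : n / m = 1 - m^-1.
  by rewrite /m -[t.+2%:R]natr1 -/n in m0 *; field; rewrite gt_eqF.
by rewrite lerD2l lerN2.
Qed.

Lemma sum_rate b T : 0 <= b <= 1 / 2 -> (1 <= T)%N ->
  \sum_(1 <= t < T.+1) rate b t <= 3 * T%:R `^ (1 - b).
Proof.
move=> b01 T1; have /andP[b0 b2] := b01.
case: T T1 => // n _.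
have h : \sum_(2 <= t < n.+2) rate b t <= 2 * n%:R `^ (1 - b).
  elim: n => [|n IH]; first by rewrite big_geq// mulr_ge0 ?powR_ge0.
  rewrite big_nat_recr//= rateE//=.
  have [->|n1] := posnP n.
    by rewrite big_geq// !powR1; lra.
  have := powR_increment b01 n1.
  have := powR_ge0 n.+1%:R (- b) : 0 <= _ :> R.
  nra.
rewrite big_ltn// rate1.
have : n%:R `^ (1 - b) <= n.+1%:R `^ (1 - b) :> R.
  by rewrite ge0_ler_powR ?nnegrE ?ler_nat//; lra.
have : 1 <= n.+1%:R `^ (1 - b) :> R.
  by rewrite -[leLHS](powRr0 n.+1%:R) ler_powR ?ler1n//; lra.
lra.
Qed.

Lemma ge1_powRN_le b b' T : b' <= b -> (1 <= T)%N -> T%:R `^ (- b) <= T%:R `^ (- b') :> R.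
Proof. by move=> bb T1; rewrite ler_powR ?ler1n// lerN2. Qed.

Lemma horizon_le_rate b t T : 0 <= b -> (1 <= t <= T)%N -> T%:R `^ (- b) <= rate b t.
Proof.
move=> b0 tT; rewrite /rate !powRN lef_pV2 ?posrE ?powR_gt0 ?ltr0n; try lia.
by rewrite ge0_ler_powR ?nnegrE// ler_nat; lia.
Qed.

End Rates.

(** * Smooth functions on a convex set *)

Section Geometry.
Context {R : realType} {d : nat}.
Implicit Types (K : set 'rV[R]_d) (F : 'rV[R]_d -> R) (a g u v w x y : 'rV[R]_d).

Lemma convex_set_segment K x y s : @convex_set R 'rV[R]_d K -> K x -> K y ->
  0 <= s <= 1 -> K (x + s *: (y - x)).
Proof.
move=> cK Kx Ky /andP[s0 s1].
have := cK y x (Itv01 s0 s1); rewrite !inE => /(_ Ky Kx).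
by congr K; rewrite /conv/= /unstable.onem; apply/rowP => i; rewrite !mxE; ring.
Qed.

Lemma convex_function_segment K F x y s : @convex_function R 'rV[R]_d K F ->
  K x -> K y -> 0 <= s <= 1 -> F (x + s *: (y - x)) <= F x + s * (F y - F x).
Proof.
move=> cF Kx Ky /andP[s0 s1].
have e : (conv (Itv01 s0 s1) (y : convex_lmodType 'rV[R]_d) x) =
    (x + s *: (y - x)) :> 'rV[R]_d.
  by rewrite /conv/= /unstable.onem; apply/rowP => i; rewrite !mxE; ring.
have := cF (Itv01 s0 s1) y x; rewrite !inE => /(_ Ky Kx) h.
rewrite -e; apply: le_trans h _; rewrite convRE/= /unstable.onem; lra.
Qed.

(** The price of calling the linear oracle at the estimate g instead of the true
    gradient a. *)
Lemma linear_oracle_le a g v w : dotv v g <= dotv w g ->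
  dotv a v <= dotv a w + enorm (w - v) * enorm (g - a).
Proof.
move=> vw; have := cauchy_schwarz (v - w) (a - g).
rewrite enormB (enormB a) !dotvBl !dotvBr (dotvC v a) (dotvC w a); lra.
Qed.

(** Trades the error e for its square at a scale r of choice, so that only mean squares
    of errors have to be estimated. *)
Lemma young (r e : R) : 0 < r -> e <= (e ^+ 2 / r + r) / 2.
Proof.
move=> r0; rewrite ler_pdivlMr// -subr_ge0.
have -> : e ^+ 2 / r + r - e * 2 = (e - r) ^+ 2 / r by field; rewrite gt_eqF.
by rewrite divr_ge0 ?sqr_ge0 ?ltW.
Qed.

Section Smooth.
Variables (K : set 'rV[R]_d) (F : 'rV[R]_d -> R) (G L D : R).
Hypotheses (convK : @convex_set R 'rV[R]_d K) (L_ge0 : 0 <= L)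
  (diffF : forall x, K x -> differentiable F x)
  (gradF_le : forall x, K x -> enorm (grad F x) <= G)
  (gradF_lip : forall x y, K x -> K y ->
     enorm (grad F x - grad F y) <= L * enorm (x - y))
  (diamK : forall x y, K x -> K y -> enorm (x - y) <= D).

Lemma mean_value x y : K x -> K y ->
  exists2 s, 0 <= s <= 1 & F y - F x = dotv (grad F (x + s *: (y - x))) (y - x).
Proof.
move=> Kx Ky; have [s s01|s s01 e] := @mvt_segment _ _ F x (y - x).
  by apply: diffF; exact: convex_set_segment.
by exists s => //; rewrite -e [x + _]addrC subrK.
Qed.

Lemma objective_lip x y : K x -> K y -> `|F x - F y| <= G * enorm (x - y).
Proof.
move=> Kx Ky; have [s s01 ->] := mean_value Ky Kx.
apply: le_trans (normr_dotv_le _ _) _.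
by rewrite ler_wpM2r ?enorm_ge0// gradF_le//; exact: convex_set_segment.
Qed.

(** The mean value theorem yields L where Taylor's formula would yield L / 2; the
    constant does not affect the rates. *)
Lemma descent x y : K x -> K y ->
  `|F y - F x - dotv (grad F x) (y - x)| <= L * enorm (y - x) ^+ 2.
Proof.
move=> Kx Ky; have [s s01 ->] := mean_value Kx Ky.
have Ks := convex_set_segment convK Kx Ky s01.
rewrite -dotvBl; apply: le_trans (normr_dotv_le _ _) _.
rewrite expr2 mulrA ler_wpM2r ?enorm_ge0//.
apply: le_trans (gradF_lip Ks Kx) _; rewrite ler_wpM2l//.
have /andP[s0 s1] := s01.
by rewrite addrC addKr enormZ ger0_norm// ler_piMl ?enorm_ge0.
Qed.

Lemma convex_first_order x y : @convex_function R 'rV[R]_d K F ->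
  K x -> K y -> dotv (grad F x) (y - x) <= F y - F x.
Proof.
move=> cF Kx Ky; apply: dotv_grad_le; first exact: diffF.
by move=> s /andP[s0 s1]; apply: convex_function_segment => //; rewrite ltW.
Qed.

(** One minimization step, in terms of an arbitrary competitor w: a minimizer of F in
    the convex case, a point attaining the gap in the non-convex one. *)
Lemma frank_wolfe_step x v w g (eta r : R) : K x -> K v -> K w ->
  0 <= eta <= 1 -> 0 < r -> dotv v g <= dotv w g ->
  F (x + eta *: (v - x)) <= F x + eta * (dotv (grad F x) (w - x)
    + D * ((dotv (g - grad F x) (g - grad F x) / r + r) / 2)) + L * (eta * D) ^+ 2.
Proof.
move=> Kx Kv Kw eta01 r0 vw; have /andP[eta0 eta1] := eta01.
have := descent Kx (convex_set_segment convK Kx Kv eta01).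
rewrite ler_norml => /andP[_]; rewrite [x + _ - x]addrAC subrr add0r dotvZr.
have step : L * enorm (eta *: (v - x)) ^+ 2 <= L * (eta * D) ^+ 2.
  rewrite ler_wpM2l// enormZ ger0_norm//.
  have D0 : 0 <= D by exact: le_trans (enorm_ge0 _) (diamK Kv Kx).
  have Dvx := ler_wpM2l eta0 (diamK Kv Kx).
  by rewrite ler_pXn2r// ?nnegrE ?mulr_ge0 ?enorm_ge0.
have lin : dotv (grad F x) (v - x) <= dotv (grad F x) (w - x)
    + D * ((dotv (g - grad F x) (g - grad F x) / r + r) / 2).
  have := linear_oracle_le (grad F x) vw.
  have := young (enorm (g - grad F x)) r0; rewrite sqr_enorm => y1.
  have : enorm (w - v) * enorm (g - grad F x) <=
     D * ((dotv (g - grad F x) (g - grad F x) / r + r) / 2).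
    by rewrite ler_pM ?enorm_ge0// diamK.
  rewrite !dotvBr; lra.
have := ler_wpM2l eta0 lin; lra.
Qed.

(** One maximization step. The iterate moves by eta v rather than towards v, so the
    radius of K replaces its diameter in the second-order term. *)
Lemma submodular_step x v w g (eta r Rad : R) : K x -> K v -> K w ->
  K (x + eta *: v) -> enorm v <= Rad -> 0 <= eta -> 0 < r ->
  dotv w g <= dotv v g ->
  F x + eta * (dotv (grad F x) w
    - D * ((dotv (g - grad F x) (g - grad F x) / r + r) / 2)) - L * (eta * Rad) ^+ 2
  <= F (x + eta *: v).
Proof.
move=> Kx Kv Kw Kx' vR eta0 r0 wv.
have := descent Kx Kx'; rewrite [x + _ - x]addrAC subrr add0r dotvZr.
rewrite ler_norml => /andP[h _].
have step : L * enorm (eta *: v) ^+ 2 <= L * (eta * Rad) ^+ 2.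
  have R0 : 0 <= Rad by exact: le_trans (enorm_ge0 _) vR.
  have vR' := ler_wpM2l eta0 vR.
  rewrite ler_wpM2l// enormZ ger0_norm//.
  by rewrite ler_pXn2r// ?nnegrE ?mulr_ge0 ?enorm_ge0.
have lin : dotv (grad F x) w
    - D * ((dotv (g - grad F x) (g - grad F x) / r + r) / 2) <= dotv (grad F x) v.
  have := linear_oracle_le (grad F x) wv.
  have := young (enorm (g - grad F x)) r0; rewrite sqr_enorm => y1.
  have : enorm (v - w) * enorm (g - grad F x) <=
     D * ((dotv (g - grad F x) (g - grad F x) / r + r) / 2).
    by rewrite ler_pM ?enorm_ge0// diamK.
  lra.
have := ler_wpM2l eta0 lin; lra.
Qed.

Section Gap.
Hypotheses (compK : compact K) (K0 : K !=set0).

Lemma fw_gapP x : is_max [set dotv (v - x) (- grad F x) | v in K] (fw_gap K F x).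
Proof.
apply: getPex.
have cont : {within K, continuous (fun v => dotv (v - x) (- grad F x))}.
  apply: continuous_subspaceT => v.
  apply: continuous_big => //; first exact: add_continuous.
  move=> i _ u.
  rewrite (_ : (fun w : 'rV[R]_d => _) =
    (fun s : R => (s - x ord0 i) * (- grad F x) ord0 i) \o (fun w => w ord0 i)).
    apply: continuous_comp; first exact: coord_continuous.
    by apply: cvgM; [apply: cvgB; [exact: cvg_id|exact: cvg_cst]|exact: cvg_cst].
  by apply/funext => w; rewrite /= !mxE.
have [w wK wmax] := EVT_max_rV K0 compK cont.
exists (dotv (w - x) (- grad F x)); split.
  by exists w => //; move: wK; rewrite inE.
by move=> _ [u Ku <-]; apply: wmax; rewrite inE.
Qed.

Lemma fw_gap_attained x : exists2 w, K w & dotv (grad F x) (w - x) = - fw_gap K F x.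
Proof.
by have [[w Kw <-] _] := fw_gapP x; exists w => //; rewrite dotvNr opprK dotvC.
Qed.

Lemma fw_gap_ge x w : K w -> - dotv (grad F x) (w - x) <= fw_gap K F x.
Proof.
move=> Kw; have [_] := fw_gapP x; apply; exists w => //.
by rewrite dotvNr dotvC.
Qed.

(** The gap is a maximum of functions of x with a common Lipschitz constant. *)
Lemma fw_gap_lip x y : K x -> K y ->
  `|fw_gap K F x - fw_gap K F y| <= (G + L * D) * enorm (x - y).
Proof.
have half u u' : K u -> K u' ->
    fw_gap K F u - fw_gap K F u' <= (G + L * D) * enorm (u - u').
  move=> Ku Ku'; have [w Kw e] := fw_gap_attained u.
  have split_diff : dotv (grad F u') (w - u') - dotv (grad F u) (w - u) =
      dotv (grad F u' - grad F u) (w - u) + dotv (grad F u') (u - u').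
    by rewrite dotvBl addrAC -dotvDr subrKA.
  have -> : fw_gap K F u = - dotv (grad F u) (w - u) by rewrite e opprK.
  apply: (@le_trans _ _ (dotv (grad F u') (w - u') - dotv (grad F u) (w - u))).
    by rewrite addrC lerD2r lerNl; exact: fw_gap_ge.
  rewrite split_diff mulrDl addrC; apply: lerD.
    apply: le_trans (cauchy_schwarz _ _) _.
    by rewrite ler_wpM2r ?enorm_ge0// gradF_le.
  apply: le_trans (cauchy_schwarz _ _) _.
  by rewrite mulrAC ler_pM ?enorm_ge0 ?diamK// enormB gradF_lip.
move=> Kx Ky; rewrite ler_norml; apply/andP; split; last exact: half.
by rewrite lerNl opprB enormB; exact: half.
Qed.

End Gap.

Section Submodular.
Variable Xi : 'I_d -> set R.
Hypotheses (Xi_ge0 : forall i, Xi i `<=` [set r | 0 <= r])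
  (K_0 : K 0) (K_box : K `<=` box Xi)
  (monoF : monotone_on (box Xi) F) (subF : dr_submodular (box Xi) F).

(** The factors of the box need not be intervals, but each contains the projection of
    K, which is one. *)
Lemma box_between x y u : K x -> K y ->
  (forall i, exists2 s, 0 <= s <= 1 & u ord0 i = x ord0 i + s * (y ord0 i - x ord0 i)) ->
  box Xi u.
Proof.
move=> Kx Ky us i; have [s s01 ->] := us i.
have := K_box (convex_set_segment convK Kx Ky s01) i.
by rewrite !mxE.
Qed.

(** Split y as (x \/ y - x) + (x /\ y). Along the first, nonnegative direction the
    gradient decreases, so F is concave between x and x \/ y and the derivative at x is
    at least F (x \/ y) - F x, hence at least F y - F x by monotonicity. Along the
    second the derivative is nonnegative by monotonicity, seen from the points
    x - s (x /\ y), which lie in the box because 0 and x are in K. *)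
Lemma submodular_first_order x y : K x -> K y ->
  F y - F x <= dotv (grad F x) y.
Proof.
move=> Kx Ky; have [_ [dF antiF]] := subF.
have x0 i : 0 <= x ord0 i by exact: Xi_ge0 (K_box Kx i).
have y0 i : 0 <= y ord0 i by exact: Xi_ge0 (K_box Ky i).
pose up : 'rV[R]_d := \row_i Num.max 0 (y ord0 i - x ord0 i).
pose low : 'rV[R]_d := \row_i Num.min (x ord0 i) (y ord0 i).
have yE : y = up + low.
  apply/rowP => i; rewrite !mxE; case: (leP (x ord0 i) (y ord0 i)) => h.
    by rewrite max_r ?subr_ge0// subrK.
  by rewrite max_l ?subr_le0 ?ltW// add0r.
have box_up s : 0 <= s <= 1 -> box Xi (x + s *: up).
  move=> s01; apply: (box_between Kx Ky) => i; rewrite !mxE.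
  case: (leP (x ord0 i) (y ord0 i)) => h.
    by exists s => //; rewrite max_r ?subr_ge0.
  by exists 0; rewrite ?lexx ?ler01// max_l ?subr_le0 ?ltW// mulr0 mul0r.
have box_low s : 0 <= s <= 1 -> box Xi (x + s *: - low).
  move=> /andP[s0 s1]; apply: (box_between Kx K_0) => i; rewrite !mxE.
  have [xi0|xi0] := eqVneq (x ord0 i) 0.
    by exists 0; rewrite ?lexx ?ler01// xi0 min_l// oppr0 !mulr0 mul0r.
  have xi : 0 < x ord0 i by rewrite lt0r xi0 x0.
  set m := Num.min _ _.
  have m0 : 0 <= m by rewrite /m le_min x0 y0.
  have mx : m <= x ord0 i by rewrite /m ge_min lexx.
  exists (s * m / x ord0 i); last by field.
  rewrite divr_ge0 ?mulr_ge0//= ler_pdivrMr// mul1r.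
  by apply: le_trans mx; rewrite ler_piMl.
have low_grad : 0 <= dotv (grad F x) low.
  rewrite -oppr_le0 -dotvNr; apply: dotv_grad_le => [|s /andP[s0 s1]].
    exact: diffF.
  rewrite mulr0 addr0; apply: monoF.
  - by apply: box_low; rewrite ltW.
  - exact: K_box.
  - move=> i; rewrite !mxE gerDl mulrN oppr_le0 mulr_ge0 ?(ltW s0)//.
    by rewrite le_min x0 y0.
have [s s01 e] := @mvt_segment _ _ F x up (fun s s01 => dF _ (box_up s s01)).
have up_grad : F (x + up) - F x <= dotv (grad F x) up.
  rewrite e; apply: ler_sum => i _; have up0 : 0 <= up ord0 i.
    by rewrite mxE le_max lexx.
  rewrite ler_wpM2r//; apply: antiF => //; [exact: K_box|exact: box_up|].
  move=> j; rewrite !mxE lerDl mulr_ge0//; first by case/andP: s01.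
  by rewrite le_max lexx.
have : F y <= F (x + up).
  apply: monoF; first exact: K_box.
  - by rewrite -[up]scale1r; apply: box_up; rewrite ler01 lexx.
  - by move=> i; rewrite !mxE -lerBlDl le_max lexx orbT.
have -> : dotv (grad F x) y = dotv (grad F x) up + dotv (grad F x) low.
  by rewrite -dotvDr -yE.
lra.
Qed.

End Submodular.
End Smooth.
End Geometry.

(** * Variance of the gradient estimate *)

Section VectorMean.
Context {R : realType} {d : nat} {dZ : measure_display} {Z : measurableType dZ}.
Variable p : probability Z R.

Lemma bm_coord (W : Z -> 'rV[R]_d) M : coord_measurable W ->
  (forall z, enorm (W z) <= M) -> forall i, bounded_measurable (fun z => W z ord0 i).
Proof.
move=> mW WM i; split; first exact: mW.
by exists M => z; exact: le_trans (normr_coord_le_enorm _ _) (WM z).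
Qed.

Lemma bm_dotv (U W : Z -> 'rV[R]_d) M N : coord_measurable U ->
  coord_measurable W -> (forall z, enorm (U z) <= M) ->
  (forall z, enorm (W z) <= N) -> bounded_measurable (fun z => dotv (U z) (W z)).
Proof.
by move=> mU mW UM WN; apply: bm_sum => i; apply: bmM; apply: bm_coord => //; eauto.
Qed.

(** The norm of a mean is at most the largest norm: test the mean m against itself,
    |m|^2 = E <m, W> <= |m| M. *)
Lemma enorm_mean_le (W : Z -> 'rV[R]_d) (m : 'rV[R]_d) M : coord_measurable W ->
  (forall z, enorm (W z) <= M) -> (forall i, \int[p]_z W z ord0 i = m ord0 i) ->
  enorm m <= M.
Proof.
move=> mW WM mE.
have M0 : 0 <= M by exact: le_trans (enorm_ge0 _) (WM point).
have bW := bm_coord mW WM.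
have : dotv m m <= enorm m * M.
  rewrite -(mean_cst p (_ * M)).
  have -> : dotv m m = \int[p]_z (\sum_(i < d) m ord0 i * W z ord0 i).
    rewrite mean_sum => [|i]; last exact: bmZ.
    by apply: eq_bigr => i _; rewrite meanZ// mE.
  apply: mean_le => [||z]; [by apply: bm_sum => i; exact: bmZ|exact: bm_cst|].
  apply: le_trans (cauchy_schwarz _ _) _.
  by rewrite ler_wpM2l// enorm_ge0.
have [->//|m0] := eqVneq (enorm m) 0.
by rewrite -sqr_enorm expr2 ler_pM2l// lt0r m0 enorm_ge0.
Qed.

End VectorMean.

Section SubSigma.
Context {R : realType} {d : nat} {dO : measure_display} {Omega : measurableType dO}.

Lemma coord_measurable_sub (G1 G2 : set (set Omega)) (X : Omega -> 'rV[R]_d) :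
  <<s G1 >> `<=` <<s G2 >> ->
  coord_measurable (X : g_sigma_algebraType G1 -> _) ->
  coord_measurable (X : g_sigma_algebraType G2 -> _).
Proof. by move=> G12 mX i _ A mA; apply: G12; exact: (mX i measurableT A mA). Qed.

Lemma coord_measurable_full (G : set (set Omega)) (X : Omega -> 'rV[R]_d) :
  <<s G >> `<=` measurable ->
  coord_measurable (X : g_sigma_algebraType G -> _) -> coord_measurable X.
Proof. by move=> GO mX i _ A mA; apply: GO; exact: (mX i measurableT A mA). Qed.

End SubSigma.

Lemma contraction_rate {R : realType} (c a b : R) : 0 <= c -> 0 <= b <= 1 ->
  (1 - b) * a <= b -> (1 - b) ^+ 2 * (c * a) + c * b ^+ 2 <= c * b.
Proof.
move=> c0 /andP[b0 b1] ab.
have : c * ((1 - b) * ((1 - b) * a)) <= c * ((1 - b) * b).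
  by rewrite !ler_wpM2l ?subr_ge0.
lra.
Qed.

Section Oracle.
Context {R : realType} {d : nat} {dZ : measure_display} {Z : measurableType dZ}.
Variables (p : probability Z R) (K : set 'rV[R]_d).
Variables (Ft : 'rV[R]_d -> Z -> R) (F : 'rV[R]_d -> R) (B G L : R).
Hypotheses
  (Ft_meas : forall x, measurable_fun setT (Ft x))
  (grad_meas : forall x i, measurable_fun setT (fun z => grad (Ft ^~ z) x ord0 i))
  (mean_Ft : forall x, K x -> ('E_p[Ft x] = (F x)%:E)%E)
  (mean_grad : forall x i, K x ->
     ('E_p[fun z => grad (Ft ^~ z) x ord0 i] = (grad F x ord0 i)%:E)%E)
  (Ft_le : forall x z, K x -> `|Ft x z| <= B)
  (grad_le : forall x z, K x -> enorm (grad (Ft ^~ z) x) <= G)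
  (grad_lip : forall x y z, K x -> K y ->
     enorm (grad (Ft ^~ z) x - grad (Ft ^~ z) y) <= L * enorm (x - y)).

Lemma objective_le x : K x -> `|F x| <= B.
Proof.
move=> Kx.
have bF : bounded_measurable (Ft x) by split => //; exists B => z; exact: Ft_le.
have := mean_Ft Kx; rewrite expectationE// => -[<-].
by apply: normr_mean_le => // z; exact: Ft_le.
Qed.

Lemma mean_gradE x i : K x -> \int[p]_z grad (Ft ^~ z) x ord0 i = grad F x ord0 i.
Proof.
move=> Kx; have := mean_grad i Kx; rewrite expectationE => [[]//|].
by apply: (@bm_coord _ _ _ _ _ G) => // z; exact: grad_le.
Qed.

Lemma gradF_le x : K x -> enorm (grad F x) <= G.
Proof.
move=> Kx; apply: (@enorm_mean_le _ _ _ _ p (fun z => grad (Ft ^~ z) x)) => //.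
- by move=> z; exact: grad_le.
- by move=> i; exact: mean_gradE.
Qed.

Lemma grad_bound_ge0 x : K x -> 0 <= G.
Proof. by move=> Kx; exact: le_trans (enorm_ge0 _) (gradF_le Kx). Qed.

Lemma gradF_lip x y : K x -> K y ->
  enorm (grad F x - grad F y) <= L * enorm (x - y).
Proof.
move=> Kx Ky.
have mxy : coord_measurable (fun z => grad (Ft ^~ z) x - grad (Ft ^~ z) y).
  by apply: coord_measurableB => i.
apply: (@enorm_mean_le _ _ _ _ p _ _ _ mxy) => [z|i]; first exact: grad_lip.
have bg u : K u -> bounded_measurable (fun z => grad (Ft ^~ z) u ord0 i).
  by move=> Ku; apply: (@bm_coord _ _ _ _ _ G) => // z; exact: grad_le.
have E : (fun z => (grad (Ft ^~ z) x - grad (Ft ^~ z) y) ord0 i) =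
  fun z => grad (Ft ^~ z) x ord0 i + (-1) * grad (Ft ^~ z) y ord0 i.
  by apply/funext => z; rewrite !mxE mulN1r.
rewrite (_ : Rintegral _ _ _ = \int[p]_z (grad (Ft ^~ z) x ord0 i + (-1) *
   grad (Ft ^~ z) y ord0 i)); last by rewrite E.
rewrite meanD ?meanZ//; try exact: bg; last exact/bmZ/bg.
by rewrite !mean_gradE// !mxE mulN1r.
Qed.

Definition noise (x : 'rV[R]_d) (z : Z) := grad (Ft ^~ z) x - grad F x.

Lemma noise_le x z : K x -> enorm (noise x z) <= 2 * G.
Proof.
move=> Kx; apply: le_trans (enormD _ _) _; rewrite enormN.
apply: le_trans (lerD (grad_le z Kx) (gradF_le Kx)) _.
by rewrite mulr_natl mulr2n.
Qed.

Lemma noise_lip x y z : K x -> K y ->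
  enorm (noise x z - noise y z) <= 2 * L * enorm (x - y).
Proof.
move=> Kx Ky; rewrite (_ : noise x z - noise y z =
  (grad (Ft ^~ z) x - grad (Ft ^~ z) y) - (grad F x - grad F y)).
  apply: le_trans (enormD _ _) _; rewrite enormN.
  apply: le_trans (lerD (grad_lip z Kx Ky) (gradF_lip Kx Ky)) _.
  by rewrite -mulrA mulr_natl mulr2n.
by apply/rowP => i; rewrite !mxE; ring.
Qed.

Lemma noise_meas x : coord_measurable (noise x).
Proof. by apply: coord_measurableB => i //; exact: measurable_cst. Qed.

Lemma mean_noise x i : K x -> \int[p]_z noise x z ord0 i = 0.
Proof.
move=> Kx; have bg : bounded_measurable (fun z => grad (Ft ^~ z) x ord0 i).
  by apply: (@bm_coord _ _ _ _ _ G) => // z; exact: grad_le.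
have E : (fun z => noise x z ord0 i) =
  fun z => grad (Ft ^~ z) x ord0 i + (- grad F x ord0 i).
  by apply/funext => z; rewrite !mxE.
rewrite (_ : Rintegral _ _ _ = \int[p]_z (grad (Ft ^~ z) x ord0 i + - grad F x ord0 i)).
  by rewrite meanD ?mean_cst ?mean_gradE ?subrr//; exact: bm_cst.
by rewrite E.
Qed.

Section Orthogonality.
Context {dO : measure_display} {Omega : measurableType dO}.
Variables (P : probability Omega R) (H : set (set Omega)) (zeta : Omega -> Z).
Let OmegaH : measurableType _ := g_sigma_algebraType H.
Hypotheses (H_meas : <<s H >> `<=` measurable)
  (zeta_meas : measurable_fun setT zeta)
  (zeta_indep : forall A B, <<s H >> A -> measurable B ->
     P (A `&` zeta @^-1` B) = (P A * p B)%E).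

(** The fresh sample makes the noise orthogonal to everything already revealed: with
    the past frozen, U w and X w are constants and the noise at X w has mean zero. *)
Lemma mean_dotv_noise (U X : Omega -> 'rV[R]_d) M :
  coord_measurable (U : OmegaH -> _) -> (forall w, enorm (U w) <= M) ->
  coord_measurable (X : OmegaH -> _) -> (forall w, K (X w)) ->
  \int[P]_w dotv (U w) (noise (X w) (zeta w)) = 0.
Proof.
move=> mU UM mX KX.
pose f i (u : OmegaH * Z) := U u.1 ord0 i * noise (X u.1) u.2 ord0 i.
have bf i : bounded_measurable (f i).
  apply: bmM.
    split; first exact: (measurableT_comp (mU i) measurable_fst).
    by exists M => u; exact: le_trans (normr_coord_le_enorm _ _) (UM _).
  split; last first.
    by exists (2 * G) => u; apply: le_trans (normr_coord_le_enorm _ _) (noise_le _ _).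
  apply: (@measurable_lipschitz _ _ _ _ K (fun x (u : OmegaH * Z) => noise x u.2 ord0 i)
    (fun u => X u.1) (2 * L)) => //.
  - by move=> x _; exact: (measurableT_comp (noise_meas x i) measurable_snd).
  - move=> x y w Kx Ky; apply: le_trans (noise_lip w.2 Kx Ky).
    exact: normr_coordB_le.
  - by move=> j; exact: (measurableT_comp (mX j) measurable_fst).
have bfz i : bounded_measurable (fun w => f i (w, zeta w)).
  have [mf [N fN]] := bf i; split; last by exists N.
  apply: (measurableT_comp mf); apply: measurable_fun_pair => //.
  by move=> _ A mA; rewrite setTI; exact: H_meas.
rewrite /dotv (mean_sum P) => [|i]; last exact: bfz.
rewrite big1// => i _.
rewrite [LHS](mean_indep H_meas zeta_meas zeta_indep (bf i)).
rewrite -[RHS](mean_cst P); apply: eq_Rintegral => w _.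
rewrite /f/= meanZ ?mean_noise ?mulr0//.
split; first exact: noise_meas.
by exists (2 * G) => u; apply: le_trans (normr_coord_le_enorm _ _) (noise_le _ _).
Qed.

End Orthogonality.

Section Run.
Context {dO : measure_display} {Omega : measurableType dO}.
Variables (P : probability Omega R) (T : nat) (rho : nat -> R) (x1 : 'rV[R]_d).
Variables (z : nat -> Omega -> Z) (x g v : nat -> Omega -> 'rV[R]_d).

(** The generators of [history z v t], named so that the sigma-algebra can be turned
    into a measurable type. *)
Definition revealed (t : nat) : set (set Omega) :=
  \bigcup_(s in [set s | (1 <= s < t)%N])
    (preimage_set_system setT (z s) measurable `|`
     \bigcup_(i : 'I_d)
       preimage_set_system setT (fun w => v s w ord0 i) measurable).

Local Notation past t := (g_sigma_algebraType (revealed t)).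

Lemma history_mono s t : (s <= t)%N -> history z v s `<=` history z v t.
Proof.
move=> st; apply: smallest_sub; first exact: smallest_sigma_algebra.
move=> A [r /= /andP[r1 rs] Ar]; apply: sub_sigma_algebra; exists r => //=.
by rewrite r1 (leq_trans rs).
Qed.

Lemma coord_measurable_later s t (X : Omega -> 'rV[R]_d) : (s <= t)%N ->
  coord_measurable (X : past s -> _) -> coord_measurable (X : past t -> _).
Proof. by move=> st; apply: coord_measurable_sub; exact: history_mono. Qed.

Lemma measurable_sample s t : (1 <= s < t)%N -> measurable_fun (setT : set (past t)) (z s).
Proof.
by move=> st _ A mA; apply: sub_sigma_algebra; exists s => //; left; exists A.
Qed.

Lemma measurable_answer s t : (1 <= s < t)%N -> coord_measurable (v s : past t -> _).
Proof.
move=> st i _ A mA; apply: sub_sigma_algebra; exists s => //; right.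
by exists i => //; exists A.
Qed.

Hypothesis est : sfw_estimator p P Ft T rho x1 z x g v.

Lemma history_measurable t : (t <= T.+1)%N -> history z v t `<=` measurable.
Proof.
move=> tT; apply: smallest_sub; first exact: sigma_algebra_measurable.
move=> A [s /= /andP[s1 st]].
have sT : (1 <= s <= T)%N by rewrite s1 -ltnS (leq_trans st).
case=> [|[i _]] [C mC <-]; first exact: sfw_z_meas est _ sT measurableT _ mC.
exact: sfw_v_meas est _ sT _ measurableT _ mC.
Qed.

(* An affine update covers x + eta (v - x) as well as x + eta v. *)
Variables (a b : nat -> R).
Hypotheses
  (update : forall t w, (1 <= t <= T)%N -> x t.+1 w = a t *: x t w + b t *: v t w)
  (Kx : forall t w, (1 <= t <= T.+1)%N -> K (x t w)).

Lemma iterate_past t : (1 <= t <= T.+1)%N -> coord_measurable (x t : past t -> _).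
Proof.
elim: t => // -[_ _ i|t IH tT].
  rewrite (_ : (fun w => _) = fun=> x1 ord0 i); first exact: measurable_cst.
  by apply/funext => w; rewrite (sfw_x_init est).
have tT' : (1 <= t.+1 <= T)%N by [].
rewrite (_ : x t.+2 = fun w => a t.+1 *: x t.+1 w + b t.+1 *: v t.+1 w).
  apply: coord_measurable_lin; last by apply: measurable_answer; nat_lia.
  by apply: (coord_measurable_later (leqnSn _)); apply: IH; nat_lia.
by apply/funext => w; rewrite update.
Qed.

Lemma stochastic_gradient_past s t r : (1 <= s <= t)%N -> (t <= T.+1)%N -> (1 <= r < t)%N ->
  coord_measurable ((fun w => grad (Ft ^~ (z r w)) (x s w)) : past t -> _).
Proof.
move=> /andP[s1 st] tT rt i.
apply: (@measurable_lipschitz _ _ _ (past t) K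
  (fun y w => grad (Ft ^~ (z r w)) y ord0 i) (x s) L) => //.
- by move=> y _; exact: (measurableT_comp (grad_meas y i) (measurable_sample rt)).
- move=> y y' w Ky Ky'; apply: le_trans (grad_lip (z r w) Ky Ky').
  exact: normr_coordB_le.
- by move=> w; apply: Kx; nat_lia.
- by apply: (coord_measurable_later st); apply: iterate_past; nat_lia.
Qed.

Lemma estimate_past t : (1 <= t <= T)%N -> coord_measurable (g t : past t.+1 -> _).
Proof.
elim: t => // -[_ tT|t IH tT].
  rewrite (_ : g 1 = fun w => grad (Ft ^~ (z 1 w)) (x 1 w)).
    exact: stochastic_gradient_past.
  by apply/funext => w; rewrite (sfw_g_init est).
rewrite (_ : g t.+2 = fun w => (1 - rho t.+2) *: g t.+1 w +
   1 *: (1 *: grad (Ft ^~ (z t.+2 w)) (x t.+2 w) +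
    (rho t.+2 - 1) *: grad (Ft ^~ (z t.+2 w)) (x t.+1 w))).
  have mg s : (1 <= s <= t.+3)%N ->
      coord_measurable ((fun w => grad (Ft ^~ (z t.+2 w)) (x s w)) : past t.+3 -> _).
    by move=> s1; apply: stochastic_gradient_past; nat_lia.
  apply: coord_measurable_lin.
    by apply: (coord_measurable_later (leqnSn _)); apply: IH; nat_lia.
  by apply: coord_measurable_lin; apply: mg; nat_lia.
apply/funext => w; rewrite (sfw_g_step est)//=; apply/rowP => i; rewrite !mxE; ring.
Qed.

Definition err t w := g t w - grad F (x t w).

Lemma gradF_past s t : (1 <= s <= t)%N -> (t <= T.+1)%N ->
  coord_measurable ((fun w => grad F (x s w)) : past t -> _).
Proof.
move=> /andP[s1 st] tT i.
apply: (@measurable_lipschitz _ _ _ (past t) K (fun y w => grad F y ord0 i) (x s) L) => //.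
- move=> y y' w Ky Ky'; apply: le_trans (gradF_lip Ky Ky').
  exact: normr_coordB_le.
- by move=> w; apply: Kx; nat_lia.
- by apply: (coord_measurable_later st); apply: iterate_past; nat_lia.
Qed.

Lemma err_past t : (1 <= t <= T)%N -> coord_measurable (err t : past t.+1 -> _).
Proof.
move=> tT; apply: (@coord_measurableB _ _ _ (past t.+1) (g t) (fun w => grad F (x t w))).
  exact: estimate_past.
by apply: gradF_past; nat_lia.
Qed.

(** The correction term of the estimator is there for this identity: the drift of the
    gradient cancels, and the old error is contracted up to fresh noise. *)
Lemma err_step t w : (1 <= t < T)%N ->
  err t.+1 w = (1 - rho t.+1) *: err t w +
   (noise (x t.+1 w) (z t.+1 w) - (1 - rho t.+1) *: noise (x t w) (z t.+1 w)).
Proof.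
move=> /andP[t1 tT]; rewrite /err (sfw_g_step est) ?ltnS ?t1//= /noise.
by apply/rowP => i; rewrite !mxE; ring.
Qed.

Variables (beta M : R).
Local Notation phi := (rate (2 * beta)).
Hypotheses (beta01 : 0 <= beta <= 1 / 2) (L_ge0 : 0 <= L) (M_ge0 : 0 <= M)
  (rho_phi : forall t, (2 <= t <= T)%N -> rho t = phi t)
  (x_step : forall t w, (1 <= t < T)%N -> enorm (x t.+1 w - x t w) <= M * phi t.+1).

Let phi01 t : 0 <= phi t <= 1.
Proof. by apply: rate01; have := beta01; lra. Qed.

Let phi_step t : (1 <= t)%N -> (1 - phi t.+1) * phi t <= phi t.+1.
Proof. by apply: rate_contraction; have := beta01; lra. Qed.

Let C := 2 * L * M + 2 * G.

(** The fresh noise is (1 - rho) times a difference of noises at consecutive iterates,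
    small by the Lipschitz bound, plus rho times the noise itself. *)
Lemma fresh_noise_le t w : (1 <= t < T)%N ->
  enorm (noise (x t.+1 w) (z t.+1 w) - (1 - phi t.+1) *: noise (x t w) (z t.+1 w))
  <= C * phi t.+1.
Proof.
move=> tT; have /andP[t1 tT'] := tT.
have Kt : K (x t w) by apply: Kx; nat_lia.
have Kt1 : K (x t.+1 w) by apply: Kx; nat_lia.
have /andP[p0 p1] := phi01 t.+1.
set new := noise (x t.+1 w) _; set old := noise (x t w) _.
have -> : new - (1 - phi t.+1) *: old = (1 - phi t.+1) *: (new - old) + phi t.+1 *: new.
  by apply/rowP => i; rewrite !mxE; ring.
apply: le_trans (enormD _ _) _; rewrite !enormZ !ger0_norm ?subr_ge0//.
have small : (1 - phi t.+1) * enorm (new - old) <= 1 * (2 * L * (M * phi t.+1)).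
  rewrite ler_pM ?subr_ge0 ?enorm_ge0 ?gerBl//.
  apply: le_trans (noise_lip (z t.+1 w) Kt1 Kt) _.
  by rewrite ler_wpM2l ?mulr_ge0 ?x_step.
apply: le_trans (lerD small (ler_wpM2l p0 (noise_le (z t.+1 w) Kt1))) _.
by rewrite le_eqVlt /C; apply/orP; left; apply/eqP; ring.
Qed.

Lemma err_bounded t : (1 <= t <= T)%N -> exists N, forall w, enorm (err t w) <= N.
Proof.
elim: t => // -[_ tT|t IH tT].
  exists (2 * G) => w; rewrite /err (sfw_g_init est); apply: noise_le.
  exact: Kx.
have [|N eN] := IH; first by nat_lia.
exists (N + C) => w; rewrite err_step// rho_phi//.
have /andP[p0 p1] := phi01 t.+2.
apply: le_trans (enormD _ _) _; rewrite enormZ ger0_norm ?subr_ge0//.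
apply: lerD; last first.
  apply: le_trans (fresh_noise_le _ _) _ => //.
  have G0 : 0 <= G by apply: (@grad_bound_ge0 (x 1 w)); exact: Kx.
  by rewrite ler_piMr// addr_ge0// ?mulr_ge0.
apply: le_trans (eN w); rewrite -[leRHS]mul1r ler_wpM2r ?enorm_ge0//; lra.
Qed.

Definition sq_err t w := dotv (err t w) (err t w).

Lemma sq_err_bm t : (1 <= t <= T)%N -> bounded_measurable (sq_err t).
Proof.
move=> tT; have [N eN] := err_bounded tT.
have me : coord_measurable (err t).
  by apply: coord_measurable_full (err_past tT); apply: history_measurable; case/andP: tT.
exact: (bm_dotv me me eN eN).
Qed.

(** The cross term between the old error and the fresh noise has mean zero, so the
    squared error contracts by (1 - rho)^2 and picks up O(rho^2) only. *)
Lemma mean_sq_err_step t : (1 <= t < T)%N ->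
  \int[P]_w sq_err t.+1 w <=
  (1 - phi t.+1) ^+ 2 * \int[P]_w sq_err t w + (C * phi t.+1) ^+ 2.
Proof.
move=> tT; have /andP[t1 tT'] := tT.
have ht : (1 <= t <= T)%N by nat_lia.
have ht1 : (1 <= t.+1 <= T)%N by [].
have [N eN] := err_bounded ht.
have eP := err_past ht.
have mH : history z v t.+1 `<=` measurable by apply: history_measurable; nat_lia.
have mz := sfw_z_meas est ht1.
have iz A B' : history z v t.+1 A -> measurable B' ->
    (P (A `&` z t.+1 @^-1` B') = P A * p B')%E.
  by move=> hA mB; rewrite (sfw_z_indep est)// (sfw_z_law est).
pose I1 w := dotv (err t w) (noise (x t.+1 w) (z t.+1 w)).
pose I0 w := dotv (err t w) (noise (x t w) (z t.+1 w)).
have Kt w : K (x t w) by apply: Kx; nat_lia.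
have Kt1 w : K (x t.+1 w) by apply: Kx; nat_lia.
have xP1 : coord_measurable (x t.+1 : past t.+1 -> _) by apply: iterate_past; nat_lia.
have xP0 : coord_measurable (x t : past t.+1 -> _).
  by apply: (coord_measurable_later (leqnSn _)); apply: iterate_past; nat_lia.
have mean1 : \int[P]_w I1 w = 0.
  exact: (mean_dotv_noise mH mz iz eP eN xP1 Kt1).
have mean0 : \int[P]_w I0 w = 0.
  exact: (mean_dotv_noise mH mz iz eP eN xP0 Kt).
have noise_bm s : (s == t) || (s == t.+1) ->
    bounded_measurable (fun w => dotv (err t w) (noise (x s w) (z t.+1 w))).
  move=> st; apply: (@bm_dotv _ _ _ _ _ _ N (2 * G)) => //.
  - by apply: coord_measurable_full eP.
  - have mH2 : history z v t.+2 `<=` measurable by apply: history_measurable; nat_lia.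
    apply: (coord_measurable_full mH2).
    apply: (@coord_measurableB _ _ _ (past t.+2)
      (fun w => grad (Ft ^~ (z t.+1 w)) (x s w)) (fun w => grad F (x s w))).
      by apply: stochastic_gradient_past; nat_lia.
    by apply: gradF_past; nat_lia.
  - by move=> w; apply: noise_le; case/orP: st => /eqP ->.
have b1 : bounded_measurable I1 by apply: noise_bm; rewrite eqxx orbT.
have b0 : bounded_measurable I0 by apply: noise_bm; rewrite eqxx.
have be := sq_err_bm ht; have be1 := sq_err_bm ht1.
have /andP[p0 p1] := phi01 t.+1.
pose q := 1 - phi t.+1.
apply: (@mean_le_affine _ _ _ P _ _ I0 I1 _ (- (2 * q ^+ 2)) (2 * q)) => // w.
rewrite /sq_err err_step// rho_phi//; set n := noise _ _ - _.
have nC : dotv n n <= (C * phi t.+1) ^+ 2.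
  have nle : enorm n <= C * phi t.+1 by exact: fresh_noise_le.
  have n0 := enorm_ge0 n.
  by rewrite -sqr_enorm ler_pXn2r// nnegrE// (le_trans n0).
have en : dotv (err t w) n = I1 w - q * I0 w by rewrite /n dotvBr dotvZr.
rewrite -/q (dotv_sqrD q (err t w) n) en; apply: lerD nC.
by rewrite lerD2l mulrBr addrC mulNr expr2 !mulrA.
Qed.

(** The mean squared error decays like rho_t, by [mean_sq_err_step] and
    [contraction_rate]. *)
Lemma mean_sq_err_le t : (1 <= t <= T)%N ->
  \int[P]_w sq_err t w <= C ^+ 2 * phi t.
Proof.
elim: t => // -[_ tT|t IH tT].
  have K1 w : K (x 1 w) by exact: Kx.
  have G0 := grad_bound_ge0 (K1 point).
  rewrite rate1 mulr1 -(mean_cst P (C ^+ 2)).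
  apply: mean_le => [||w]; [exact: sq_err_bm|exact: bm_cst|].
  have C0 : 0 <= C by rewrite addr_ge0 ?mulr_ge0.
  rewrite /sq_err -sqr_enorm ler_pXn2r ?nnegrE ?enorm_ge0//.
  rewrite /err (sfw_g_init est); apply: le_trans (noise_le _ (K1 w)) _.
  by rewrite lerDr ?mulr_ge0.
have tT' : (1 <= t.+1 < T)%N by nat_lia.
have ht : (1 <= t.+1 <= T)%N by nat_lia.
apply: le_trans (mean_sq_err_step tT') _.
rewrite exprMn; apply: (@le_trans _ _
  ((1 - phi t.+2) ^+ 2 * (C ^+ 2 * phi t.+1) + C ^+ 2 * phi t.+2 ^+ 2)).
  by rewrite lerD2r ler_wpM2l ?sqr_ge0// IH.
exact: contraction_rate (sqr_ge0 _) (phi01 _) (phi_step (ltn0Sn _)).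
Qed.

(** The bound of [young] on the norm of the error, at the scale sqrt(rho_t) of its root
    mean square. *)
Definition excess t w := (sq_err t w / rate beta t + rate beta t) / 2.

Lemma excessE t :
  excess t = fun w => (2^-1 / rate beta t) * sq_err t w + rate beta t / 2.
Proof.
apply/funext => w; rewrite /excess mulrDl; congr (_ + _).
by rewrite mulrC mulrCA mulrC.
Qed.

Lemma excess_bm t : (1 <= t <= T)%N -> bounded_measurable (excess t).
Proof.
move=> tT; rewrite excessE.
by apply: bmD; [apply: bmZ; exact: sq_err_bm|exact: bm_cst].
Qed.

Lemma mean_excess_le t : (1 <= t <= T)%N ->
  \int[P]_w excess t w <= (C ^+ 2 + 1) / 2 * rate beta t.
Proof.
move=> tT; have be := sq_err_bm tT.
have r0 : 0 < rate beta t by exact: rate_gt0.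
rewrite excessE (meanD P (bmZ _ be) (bm_cst _)) (meanZ P _ be) mean_cst.
have h := mean_sq_err_le tT.
rewrite -sqr_rate in h.
have q0 : 0 <= 2^-1 / rate beta t by rewrite divr_ge0 ?ltW.
apply: le_trans (lerD (ler_wpM2l q0 h) (lexx _)) _.
have -> : 2^-1 / rate beta t * (C ^+ 2 * rate beta t ^+ 2) = C ^+ 2 * rate beta t / 2.
  by field; rewrite gt_eqF.
move: (C ^+ 2) (rate beta t) => c r; lra.
Qed.

Lemma sum_excess_bm : bounded_measurable (fun w => \sum_(i < T) excess i.+1 w).
Proof. by apply: bm_sum => i; apply: excess_bm; rewrite ltn_ord. Qed.

Lemma mean_sum_excess_le : (1 <= T)%N ->
  \int[P]_w (\sum_(i < T) excess i.+1 w) <= (C ^+ 2 + 1) / 2 * (3 * T%:R `^ (1 - beta)).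
Proof.
move=> T1; rewrite mean_sum => [|i]; last by apply: excess_bm; rewrite ltn_ord.
apply: (@le_trans _ _ (\sum_(i < T) (C ^+ 2 + 1) / 2 * rate beta i.+1)).
  by apply: ler_sum => i _; apply: mean_excess_le; rewrite ltn_ord.
rewrite -mulr_sumr ler_wpM2l//; first by rewrite divr_ge0// addr_ge0 ?sqr_ge0.
apply: le_trans (sum_rate beta01 T1).
by rewrite big_add1/= big_mkord.
Qed.

End Run.
End Oracle.

(** * Convergence rates of the three methods *)

Section Sequences.
Context {R : realType}.
Implicit Types (u s : nat -> R) (n : nat).

Lemma telescope_le u s n : (forall i, (i < n)%N -> u i.+1 <= u i + s i) ->
  u n <= u 0 + \sum_(i < n) s i.
Proof.
elim: n => [|n IH] us; first by rewrite big_ord0 addr0.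
rewrite big_ord_recr/= addrA; apply: le_trans (us n _) _ => //.
by rewrite lerD2r; apply: IH => i ni; apply: us; nat_lia.
Qed.

Lemma contraction_sum_le (q : R) u s n : 0 <= q <= 1 ->
  (forall i, (i < n)%N -> 0 <= s i) ->
  (forall i, (i < n)%N -> u i.+1 <= q * u i + s i) ->
  u n <= q ^+ n * u 0 + \sum_(i < n) s i.
Proof.
move=> /andP[q0 q1]; elim: n => [|n IH] s0 us; first by rewrite big_ord0 mul1r addr0.
rewrite big_ord_recr/= addrA exprS -mulrA; apply: le_trans (us n _) _ => //.
rewrite lerD2r.
have S0 : 0 <= \sum_(i < n) s i.
  by apply: sumr_ge0 => i _; apply: s0; have := ltn_ord i; nat_lia.
have : u n <= q ^+ n * u 0 + \sum_(i < n) s i.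
  by apply: IH => i ni; [apply: s0|apply: us]; nat_lia.
move=> /(ler_wpM2l q0) /le_trans; apply; rewrite mulrDr lerD2l.
by rewrite ler_piMl.
Qed.

Lemma sum_select (f : nat -> R) n k : (1 <= k <= n)%N ->
  \sum_(i < n) f i.+1 * (k == i.+1)%:R = f k.
Proof.
case: k => // k /= kn; rewrite (bigD1 (Ordinal kn))//= eqxx mulr1 big1 ?addr0// => i ni.
rewrite (_ : _ == _ = false) ?mulr0//; apply: contra_neqF ni => /eqP[e].
by apply: val_inj; rewrite /= e.
Qed.

Lemma powR_onem (b : R) n : (1 <= n)%N -> n%:R `^ (1 - b) = n%:R * n%:R `^ (- b).
Proof.
move=> n1; rewrite powRD ?powRr1//; apply/implyP => _.
by rewrite pnatr_eq0; nat_lia.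
Qed.

Lemma onem_inv_exp_le n : (1 <= n)%N -> (1 - n%:R^-1) ^+ n <= expR (- 1) :> R.
Proof.
move=> n1; have n0 : n%:R != 0 :> R by rewrite pnatr_eq0; nat_lia.
have -> : expR (- 1) = expR (- n%:R^-1) ^+ n :> R.
  by rewrite -expRM_natl mulrN divff.
by rewrite ler_pXn2r ?nnegrE ?expR_ge0 ?expR_ge1Dx ?subr_ge0 ?invf_le1 ?ler1n ?ltr0n.
Qed.

End Sequences.

Section Algorithms.
Context {R : realType} {d : nat} {dZ : measure_display} {Z : measurableType dZ}.
Variables (p : probability Z R) (K : set 'rV[R]_d).
Variables (Ft : 'rV[R]_d -> Z -> R) (F : 'rV[R]_d -> R) (B G L D Rad : R).
Hypotheses (convK : @convex_set R 'rV[R]_d K) (compK : compact K) (K0 : K !=set0)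
  (L_ge0 : 0 <= L)
  (diamK : forall x y, K x -> K y -> enorm (x - y) <= D)
  (radK : forall x, K x -> enorm x <= Rad)
  (diffF : forall x, K x -> differentiable F x)
  (Ft_meas : forall x, measurable_fun setT (Ft x))
  (grad_meas : forall x i, measurable_fun setT (fun z => grad (Ft ^~ z) x ord0 i))
  (mean_Ft : forall x, K x -> ('E_p[Ft x] = (F x)%:E)%E)
  (mean_grad : forall x i, K x ->
     ('E_p[fun z => grad (Ft ^~ z) x ord0 i] = (grad F x ord0 i)%:E)%E)
  (Ft_le : forall x z, K x -> `|Ft x z| <= B)
  (grad_le : forall x z, K x -> enorm (grad (Ft ^~ z) x) <= G)
  (grad_lip : forall x y z, K x -> K y ->
     enorm (grad (Ft ^~ z) x - grad (Ft ^~ z) y) <= L * enorm (x - y)).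
Context {dO : measure_display} {Omega : measurableType dO}.
Variables (P : probability Omega R) (T : nat).
Variables (z : nat -> Omega -> Z) (x g v : nat -> Omega -> 'rV[R]_d).

Let gFlip := gradF_lip grad_meas mean_grad grad_le grad_lip.
Let gFle := gradF_le grad_meas mean_grad grad_le.
Let Fle := objective_le Ft_meas mean_Ft Ft_le.

Let D_ge0 : 0 <= D.
Proof. by have [y Ky] := K0; exact: le_trans (enorm_ge0 _) (diamK Ky Ky). Qed.

Let Rad_ge0 : 0 <= Rad.
Proof. by have [y Ky] := K0; exact: le_trans (enorm_ge0 _) (radK Ky). Qed.

(** The factor of T^(1 - beta) in the bound on the expected sum of [excess] over T
    iterations, when the t-th iterate moves by at most M rho_(t+1). *)
Definition noise_cost (M : R) : R := 3 * ((2 * L * M + 2 * G) ^+ 2 + 1) / 2.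

Section MinUpdate.
Variables (rho eta : nat -> R) (x1 : 'rV[R]_d) (beta : R).
Hypotheses (est : sfw_estimator p P Ft T rho x1 z x g v)
  (upd : min_update K T eta x g v) (Kx1 : K x1)
  (beta01 : 0 <= beta <= 1 / 2)
  (eta01 : forall t, (1 <= t <= T)%N -> 0 <= eta t <= 1)
  (eta_rate : forall t, (1 <= t <= T)%N -> eta t <= rate (2 * beta) t.+1)
  (rho_rate : forall t, (2 <= t <= T)%N -> rho t = rate (2 * beta) t).

Lemma min_iterate_in t w : (1 <= t <= T.+1)%N -> K (x t w).
Proof.
elim: t => // -[_ _|t IH tT]; first by rewrite (sfw_x_init est).
have tT' : (1 <= t.+1 <= T)%N by nat_lia.
have Kx : K (x t.+1 w) by apply: IH; nat_lia.
have [[Kv _] ->] := upd w tT'.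
exact: (convex_set_segment convK Kx Kv (eta01 tT')).
Qed.

Lemma min_update_affine t w : (1 <= t <= T)%N ->
  x t.+1 w = (1 - eta t) *: x t w + eta t *: v t w.
Proof.
move=> tT; have [_ ->] := upd w tT.
by apply/rowP => i; rewrite !mxE; ring.
Qed.

Lemma min_step_small t w : (1 <= t < T)%N ->
  enorm (x t.+1 w - x t w) <= D * rate (2 * beta) t.+1.
Proof.
move=> tT; have tT' : (1 <= t <= T)%N by nat_lia.
have [[Kv _] ->] := upd w tT'; have /andP[e0 _] := eta01 tT'.
rewrite [x t w + _ - _]addrAC subrr add0r enormZ ger0_norm// mulrC.
have Kx : K (x t w) by apply: min_iterate_in; nat_lia.
by rewrite ler_pM ?enorm_ge0 ?eta_rate ?diamK.
Qed.

Lemma min_mean_excess : (1 <= T)%N ->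
  \int[P]_w (\sum_(i < T) excess F x g beta i.+1 w) <=
  noise_cost D * T%:R `^ (1 - beta).
Proof.
move=> T_gt0; rewrite (_ : noise_cost D * _ =
  ((2 * L * D + 2 * G) ^+ 2 + 1) / 2 * (3 * T%:R `^ (1 - beta))).
  exact: (mean_sum_excess_le grad_meas mean_grad grad_le grad_lip est
    min_update_affine min_iterate_in beta01 L_ge0 D_ge0 rho_rate min_step_small T_gt0).
by rewrite /noise_cost; ring.
Qed.

Lemma min_excess_bm :
  bounded_measurable (fun w => \sum_(i < T) excess F x g beta i.+1 w).
Proof.
exact: (sum_excess_bm grad_meas mean_grad grad_le grad_lip est
    min_update_affine min_iterate_in beta01 L_ge0 D_ge0 rho_rate min_step_small).
Qed.

Lemma min_descent t w u : (1 <= t <= T)%N -> K u ->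
  F (x t.+1 w) <= F (x t w) + eta t * (dotv (grad F (x t w)) (u - x t w)
    + D * excess F x g beta t w) + L * (eta t * D) ^+ 2.
Proof.
move=> tT Ku; have [[Kv vmin] ->] := upd w tT.
apply: (@frank_wolfe_step _ _ K) => //; first by apply: min_iterate_in; nat_lia.
- exact: eta01.
- exact: rate_gt0.
- exact: vmin.
Qed.

End MinUpdate.

Lemma past_measurable rho x1 t (f : Omega -> R) :
  sfw_estimator p P Ft T rho x1 z x g v ->
  (t <= T.+1)%N ->
  measurable_fun (setT : set (g_sigma_algebraType (revealed z v t))) f ->
  measurable_fun setT f.
Proof.
move=> est tT mf _ A mA; apply: (history_measurable est tT).
exact: (mf measurableT A mA).
Qed.

Lemma value_past rho x1 (a b : nat -> R) (f : 'rV[R]_d -> R) M t s :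
  sfw_estimator p P Ft T rho x1 z x g v ->
  (forall t w, (1 <= t <= T)%N -> x t.+1 w = a t *: x t w + b t *: v t w) ->
  (forall t w, (1 <= t <= T.+1)%N -> K (x t w)) ->
  (forall y y', K y -> K y' -> `|f y - f y'| <= M * enorm (y - y')) ->
  (1 <= t <= s)%N -> (s <= T.+1)%N ->
  measurable_fun (setT : set (g_sigma_algebraType (revealed z v s)))
    (fun w => f (x t w)).
Proof.
move=> est aff Kx flip ts sT.
apply: (@measurable_lipschitz _ _ _ (g_sigma_algebraType (revealed z v s)) K
  (fun y _ => f y) (x t) M) => //.
- by move=> y y' _; exact: flip.
- by move=> w; apply: Kx; nat_lia.
- apply: (@coord_measurable_later _ _ _ _ _ _ z v t s); first by nat_lia.
  by apply: (iterate_past est aff); nat_lia.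
Qed.

Lemma value_bm rho x1 (a b : nat -> R) (f : 'rV[R]_d -> R) M N t :
  sfw_estimator p P Ft T rho x1 z x g v ->
  (forall t w, (1 <= t <= T)%N -> x t.+1 w = a t *: x t w + b t *: v t w) ->
  (forall t w, (1 <= t <= T.+1)%N -> K (x t w)) ->
  (forall y y', K y -> K y' -> `|f y - f y'| <= M * enorm (y - y')) ->
  (forall y, K y -> `|f y| <= N) -> (1 <= t <= T.+1)%N ->
  bounded_measurable (fun w => f (x t w)).
Proof.
move=> est aff Kx flip fN tT; split; last by exists N => w; apply: fN; apply: Kx.
apply: (past_measurable est (leqnn _)).
by apply: (value_past est aff Kx flip); nat_lia.
Qed.

Hypothesis T_gt0 : (1 <= T)%N.

Let TR_gt0 : 0 < T%:R :> R.
Proof. by rewrite ltr0n. Qed.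

(** The step size 1/t turns the contraction of the suboptimality by 1 - 1/t into a
    telescoping bound on t times the suboptimality. *)
Lemma convex_step_algebra (t F' F0 Fs a e r : R) : 0 < t ->
  F' <= F0 + t^-1 * (a + e) + L * (t^-1 * D) ^+ 2 -> a <= Fs - F0 -> t^-1 <= r ->
  t * (F' - Fs) <= (t - 1) * (F0 - Fs) + (e + L * D ^+ 2 * r).
Proof.
move=> t0 h ha tr; have tn0 : t != 0 by rewrite gt_eqF.
have := ler_wpM2l (ltW t0) h.
have -> : t * (F0 + t^-1 * (a + e) + L * (t^-1 * D) ^+ 2) =
  t * F0 + (a + e) + L * D ^+ 2 * t^-1 by field.
have : L * D ^+ 2 * t^-1 <= L * D ^+ 2 * r by rewrite ler_wpM2l ?mulr_ge0 ?sqr_ge0.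
move: (L * D ^+ 2 * t^-1) (L * D ^+ 2 * r) => i j; nra.
Qed.

(** Telescope t (F x_(t+1) - F xstar) pathwise, then take the mean. The error terms sum to
    O(T^(1/2)), and dividing by T gives the rate; the curvature terms L D^2 / t are
    absorbed in the weights, since 1/t <= rate (1/2) t. *)
Lemma convex_rate x1 xstar :
  @convex_function R 'rV[R]_d K F -> is_argmin K F xstar -> K x1 ->
  sfw_estimator p P Ft T (fun t => (t.-1%:R)^-1) x1 z x g v ->
  min_update K T (fun t => t%:R^-1) x g v ->
  (forall w, K (x T.+1 w)) /\
  ('E_P[fun w => (F (x T.+1 w) - F xstar)%R] <=
    ((D * noise_cost D + 3 * L * D ^+ 2) * T%:R `^ (- (1 / 2)))%:E)%E.
Proof.
move=> cF [Kxs xsmin] Kx1 est upd.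
have b01 : 0 <= (1 / 2 : R) <= 1 / 2 by lra.
have e2 : 2 * (1 / 2) = 1 :> R by lra.
have eta01 t : (1 <= t <= T)%N -> 0 <= (t%:R^-1 : R) <= 1.
  move=> /andP[t1 _]; rewrite invr_ge0 ler0n invf_le1 ?ltr0n// ler1n.
  by rewrite t1.
have rate_inv t : (2 <= t)%N -> rate (2 * (1 / 2)) t = t.-1%:R^-1 :> R.
  by move=> t2; rewrite rateE// e2 powR_inv1.
have eta_rate t : (1 <= t <= T)%N -> t%:R^-1 <= rate (2 * (1 / 2)) t.+1 :> R.
  by move=> tT; rewrite rate_inv//; nat_lia.
have rho_rate t : (2 <= t <= T)%N -> t.-1%:R^-1 = rate (2 * (1 / 2)) t :> R.
  by move=> tT; rewrite rate_inv//; nat_lia.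
have Kx t w : (1 <= t <= T.+1)%N -> K (x t w).
  exact: (min_iterate_in est upd Kx1 eta01).
have aff := min_update_affine upd.
split=> [w|]; first by apply: Kx; rewrite /= leqnn.
have mean_ex := min_mean_excess est upd Kx1 b01 eta01 eta_rate rho_rate T_gt0.
have ex_bm := min_excess_bm est upd Kx1 b01 eta01 eta_rate rho_rate.
have Fbm : bounded_measurable (fun w => F (x T.+1 w)).
  apply: (value_bm est aff Kx (objective_lip convK diffF gFle) Fle).
  by rewrite /= leqnn.
have Fsbm : bounded_measurable (fun w => F (x T.+1 w) - F xstar).
  by apply: bmD => //; exact: bm_cst.
rewrite expectationE// lee_fin.
pose c : R := T%:R^-1.
have path w : F (x T.+1 w) - F xstar <=
    c * D * (\sum_(i < T) excess F x g (1 / 2) i.+1 w)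
    + c * (L * D ^+ 2 * (3 * T%:R `^ (1 - 1 / 2))).
  have tel : T%:R * (F (x T.+1 w) - F xstar) <= 0%:R * (F (x 1 w) - F xstar) +
      \sum_(i < T) (D * excess F x g (1 / 2) i.+1 w + L * D ^+ 2 * rate (1 / 2) i.+1).
    apply: (@telescope_le R (fun i => i%:R * (F (x i.+1 w) - F xstar)) (fun i =>
      D * excess F x g (1 / 2) i.+1 w + L * D ^+ 2 * rate (1 / 2) i.+1)) => i iT.
    have iT' : (1 <= i.+1 <= T)%N by nat_lia.
    have := min_descent (1 / 2) est upd Kx1 eta01 w iT' Kxs.
    have -> : i%:R = i.+1%:R - 1 :> R by rewrite -natr1 addrK.
    move=> h; apply: (convex_step_algebra _ h); first by rewrite ltr0n.
      by apply: (convex_first_order diffF cF) => //; apply: Kx; nat_lia.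
    apply: (@le_trans _ _ (i.+1%:R `^ (- (1 / 2)))).
      by rewrite -powR_inv1//; apply: ge1_powRN_le => //; lra.
    by apply: horizon_le_rate; [lra|nat_lia].
  rewrite mul0r add0r big_split/= -!mulr_sumr in tel.
  have sr : \sum_(i < T) rate (1 / 2) i.+1 <= 3 * T%:R `^ (1 - 1 / 2) :> R.
    by apply: le_trans (sum_rate b01 T_gt0); rewrite big_add1/= big_mkord.
  have LD : 0 <= L * D ^+ 2 by rewrite mulr_ge0 ?sqr_ge0.
  rewrite -mulrA -mulrDr /c ler_pdivlMl//.
  by apply: (le_trans tel); rewrite lerD2l ler_wpM2l.
apply: le_trans (mean_le P Fsbm (bmD (bmZ _ ex_bm) (bm_cst _)) path) _.
rewrite (meanD P (bmZ _ ex_bm) (bm_cst _)) (meanZ P _ ex_bm) mean_cst.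
have cD : 0 <= c * D by rewrite mulr_ge0// invr_ge0.
apply: le_trans (lerD (ler_wpM2l cD mean_ex) (lexx _)) _.
rewrite powR_onem// /c.
have Tn0 : T%:R != 0 :> R by rewrite gt_eqF.
by rewrite le_eqVlt; apply/orP; left; apply/eqP; field.
Qed.

Let gap_le y : K y -> `|fw_gap K F y| <= G * D.
Proof.
move=> Ky; have [u Ku e] := fw_gap_attained F compK K0 y.
rewrite -normrN -e; apply: le_trans (normr_dotv_le _ _) _.
by rewrite ler_pM ?enorm_ge0 ?gFle ?diamK.
Qed.

Lemma nonconvex_sum_algebra (eta F' F1 E S : R) n : 0 < eta ->
  F1 <= B -> - B <= F' ->
  F' <= F1 + (eta * D * E + (L * D ^+ 2 * eta ^+ 2) *+ n - eta * S) ->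
  S <= D * E + (2 * B / eta + n%:R * (L * D ^+ 2 * eta)).
Proof.
move=> e0 h1 h2 h; rewrite -(ler_pM2l e0).
have -> : eta * (D * E + (2 * B / eta + n%:R * (L * D ^+ 2 * eta))) =
   eta * D * E + 2 * B + (L * D ^+ 2 * eta ^+ 2) *+ n.
  by rewrite -mulr_natl; field; rewrite gt_eqF.
lra.
Qed.

(** Each step lowers F by eta times the gap, up to errors, and F ranges in [-B, B]; so
    the gaps average to O(1 / (T eta) + eta) plus the error terms. The independent
    uniform index turns this average into the mean gap at the random iterate. *)
Lemma nonconvex_rate x1 (iota : Omega -> nat) : K x1 ->
  sfw_estimator p P Ft T (fun t => t.-1%:R `^ (- (2 / 3))) x1 z x g v ->
  min_update K T (fun=> T%:R `^ (- (2 / 3))) x g v ->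
  uniform_index P T z v iota ->
  (forall w, K (x (iota w) w)) /\
  ('E_P[fun w => fw_gap K F (x (iota w) w)] <=
    ((2 * B + D * noise_cost D + L * D ^+ 2) * T%:R `^ (- (1 / 3)))%:E)%E.
Proof.
move=> Kx1 est upd [iotaT iota_meas iota_unif iota_indep].
have b01 : 0 <= (1 / 3 : R) <= 1 / 2 by lra.
have e2 : 2 * (1 / 3) = 2 / 3 :> R by lra.
pose eta : R := T%:R `^ (- (2 / 3)).
have eta_gt0 : 0 < eta by rewrite powR_gt0.
have eta01 t : (1 <= t <= T)%N -> 0 <= eta <= 1.
  move=> _; rewrite ltW//= -(powRr0 T%:R) /eta -[X in _ <= _ `^ X]oppr0.
  by apply: ge1_powRN_le => //; lra.
have eta_rate t : (1 <= t <= T)%N -> eta <= rate (2 * (1 / 3)) t.+1.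
  move=> tT; rewrite rateE ?e2/=; last by nat_lia.
  rewrite /eta !powRN lef_pV2 ?posrE ?powR_gt0 ?ltr0n//; last by nat_lia.
  apply: ge0_ler_powR; rewrite ?nnegrE ?ler0n//.
  by rewrite ler_nat; nat_lia.
have rho_rate t : (2 <= t <= T)%N -> t.-1%:R `^ (- (2 / 3)) = rate (2 * (1 / 3)) t :> R.
  by move=> tT; rewrite rateE ?e2//; nat_lia.
have Kx t w : (1 <= t <= T.+1)%N -> K (x t w).
  exact: (min_iterate_in est upd Kx1 eta01).
have aff := min_update_affine upd.
split=> [w|]; first by apply: Kx; have := iotaT w; nat_lia.
have mean_ex := min_mean_excess est upd Kx1 b01 eta01 eta_rate rho_rate T_gt0.
have ex_bm := min_excess_bm est upd Kx1 b01 eta01 eta_rate rho_rate.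
have gap_lip := fw_gap_lip gFle gFlip diamK compK K0.
have gap_bm (i : 'I_T) : bounded_measurable (fun w => fw_gap K F (x i.+1 w)).
  by apply: (value_bm est aff Kx gap_lip gap_le); have := ltn_ord i; nat_lia.
have gap_past (i : 'I_T) : measurable_fun
    (setT : set (g_sigma_algebraType (revealed z v T.+1)))
    (fun w => fw_gap K F (x i.+1 w)).
  by apply: (value_past est aff Kx gap_lip) => //; have := ltn_ord i; nat_lia.
have hit_meas t : measurable_fun setT (fun w => iota w == t).
  move=> _ A _; have := iota_meas measurableT ((fun n => n == t) @^-1` A).
  by apply.
have hitE t : (fun w => iota w == t) @^-1` [set true] = iota @^-1` [set t].
  by apply/seteqP; split=> w /= /eqP.
have mH := history_measurable est (leqnn _).
have gap_hit (i : 'I_T) : \int[P]_w (fw_gap K F (x i.+1 w) * (iota w == i.+1)%:R) =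
    T%:R^-1 * \int[P]_w fw_gap K F (x i.+1 w).
  have iT : (1 <= i.+1 <= T)%N by have := ltn_ord i; nat_lia.
  apply: (mean_indicator mH (hit_meas i.+1)); rewrite ?hitE.
  - exact: iota_unif.
  - by move=> A hA; exact: iota_indep.
  - by split=> //; exists (G * D) => w; apply: gap_le; apply: Kx; nat_lia.
have hit_bm (i : 'I_T) : bounded_measurable
    (fun w => fw_gap K F (x i.+1 w) * (iota w == i.+1)%:R).
  apply: bmM => //; split; last first.
    by exists 1 => w; case: (_ == _); rewrite ?normr1 ?normr0.
  exact: (measurableT_comp (f := fun b : bool => b%:R : R) _ (hit_meas i.+1)).
have select w : fw_gap K F (x (iota w) w) =
    \sum_(i < T) fw_gap K F (x i.+1 w) * (iota w == i.+1)%:R.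
  by rewrite (sum_select (fun t => fw_gap K F (x t w))).
have -> : (fun w => fw_gap K F (x (iota w) w)) =
    (fun w => \sum_(i < T) fw_gap K F (x i.+1 w) * (iota w == i.+1)%:R).
  by apply/funext => w; exact: select.
rewrite expectationE; last exact: bm_sum.
rewrite lee_fin mean_sum//.
under eq_bigr do rewrite gap_hit.
rewrite -mulr_sumr -(mean_sum P)//.
have path w : \sum_(i < T) fw_gap K F (x i.+1 w) <=
    D * (\sum_(i < T) excess F x g (1 / 3) i.+1 w)
    + (2 * B / eta + T%:R * (L * D ^+ 2 * eta)).
  have tel : F (x T.+1 w) <= F (x 1 w) + \sum_(i < T)
      (eta * D * excess F x g (1 / 3) i.+1 w + (L * D ^+ 2 * eta ^+ 2)
        - eta * fw_gap K F (x i.+1 w)).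
    apply: (@telescope_le R (fun i => F (x i.+1 w)) (fun i =>
      eta * D * excess F x g (1 / 3) i.+1 w + (L * D ^+ 2 * eta ^+ 2)
        - eta * fw_gap K F (x i.+1 w)) T) => i iT.
    have iT' : (1 <= i.+1 <= T)%N by nat_lia.
    have [u Ku gapE] := fw_gap_attained F compK K0 (x i.+1 w).
    have := min_descent (1 / 3) est upd Kx1 eta01 w iT' Ku.
    rewrite gapE -/eta => h; apply: le_trans h _; rewrite -addrA lerD2l.
    by rewrite le_eqVlt; apply/orP; left; apply/eqP; ring.
  rewrite sumrB big_split/= sumr_const card_ord -!mulr_sumr in tel.
  have F1 : F (x 1 w) <= B by apply: le_trans (ler_norm _) (Fle (Kx _ _ _)); nat_lia.
  have FT : - B <= F (x T.+1 w).
    have := Fle (Kx T.+1 w _); rewrite ler_norml => h.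
    by have /andP[] := h (ltac:(nat_lia)).
  exact: (nonconvex_sum_algebra eta_gt0 F1 FT tel).
have Sbm : bounded_measurable (fun w => \sum_(i < T) fw_gap K F (x i.+1 w)).
  exact: bm_sum.
have rhs_bm := bmD (bmZ D ex_bm) (bm_cst (2 * B / eta + T%:R * (L * D ^+ 2 * eta))).
have Tinv : 0 <= T%:R^-1 :> R by rewrite invr_ge0.
apply: le_trans (ler_wpM2l Tinv (mean_le P Sbm rhs_bm path)) _.
rewrite (meanD P (bmZ D ex_bm) (bm_cst _)) (meanZ P D ex_bm) mean_cst.
apply: le_trans (ler_wpM2l Tinv (lerD (ler_wpM2l D_ge0 mean_ex) (lexx _))) _.
pose r : R := T%:R `^ (- (1 / 3)).
have Tn0 : T%:R != 0 :> R by rewrite gt_eqF.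
have eta_r : T%:R^-1 / eta = r.
  have -> : T%:R^-1 = eta * r.
    rewrite /eta /r -powRD ?Tn0 ?implybT// -powR_inv1 ?ler0n//.
    by congr (_ `^ _); lra.
  by rewrite mulrAC divff ?mul1r// gt_eqF.
have eta_le : eta <= r by apply: ge1_powRN_le => //; lra.
rewrite powR_onem// -/r.
have -> : T%:R^-1 * (D * (noise_cost D * (T%:R * r)) + (2 * B / eta +
    T%:R * (L * D ^+ 2 * eta))) = D * noise_cost D * r + 2 * B * (T%:R^-1 / eta)
    + L * D ^+ 2 * eta.
  by field; rewrite Tn0 gt_eqF.
rewrite eta_r.
have : L * D ^+ 2 * eta <= L * D ^+ 2 * r by rewrite ler_wpM2l ?mulr_ge0 ?sqr_ge0.
move: (noise_cost D) (L * D ^+ 2) => n0 l0; lra.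
Qed.

Lemma submodular_step_algebra (c F' F0 Fs a e l : R) : 0 <= c ->
  Fs - F0 <= a -> F0 + c * (a - D * e) - L * (c * l) ^+ 2 <= F' ->
  Fs - F' <= (1 - c) * (Fs - F0) + (c * D * e + L * l ^+ 2 * c ^+ 2).
Proof.
move=> c0 ha h; have := ler_wpM2l c0 ha.
have e1 : L * (c * l) ^+ 2 = L * l ^+ 2 * c ^+ 2 by ring.
rewrite e1 in h; lra.
Qed.

Section MaxUpdate.
Hypotheses (K_0 : K 0)
  (est : sfw_estimator p P Ft T (fun t => (t.-1%:R)^-1) 0 z x g v)
  (upd : dr_max_update K T (fun=> T%:R^-1) x g v).

(** The iterates are the partial sums (v_1 + ... + v_t) / T, that is, multiples t / T of
    averages of points of K; as 0 is in K, they stay in K. *)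
Lemma max_iterate_scaled t w : (t <= T)%N ->
  exists2 y, K y & x t.+1 w = (t%:R / T%:R) *: y.
Proof.
elim: t => [_|t IH tT].
  by exists 0 => //; rewrite (sfw_x_init est) scaler0.
have tT' : (1 <= t.+1 <= T)%N by nat_lia.
have [|y Ky xy] := IH; first by nat_lia.
have [[Kv _] ->] := upd w tT'.
have t0 : t.+1%:R != 0 :> R by rewrite pnatr_eq0.
have T0 : T%:R != 0 :> R by rewrite gt_eqF.
exists (y + t.+1%:R^-1 *: (v t.+1 w - y)).
  apply: convex_set_segment => //.
  by rewrite invr_ge0 ler0n invf_le1 ?ltr0n// ler1n.
rewrite xy; apply/rowP => i; rewrite !mxE.
have -> : t%:R = t.+1%:R - 1 :> R by rewrite -natr1 addrK.
by move: (t.+1%:R : R) t0 => s s0; field; rewrite s0 T0.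
Qed.

Lemma max_iterate_in t w : (1 <= t <= T.+1)%N -> K (x t w).
Proof.
case: t => // t tT; have [|y Ky ->] := @max_iterate_scaled t w; first by nat_lia.
rewrite -[_ *: y]add0r -[X in 0 + _ *: X]subr0; apply: convex_set_segment => //.
by rewrite divr_ge0//= ler_pdivrMr// mul1r ler_nat; nat_lia.
Qed.

Lemma max_update_affine t w : (1 <= t <= T)%N ->
  x t.+1 w = 1 *: x t w + T%:R^-1 *: v t w.
Proof. by move=> tT; have [_ ->] := upd w tT; rewrite scale1r. Qed.

Let rate_inv t : (2 <= t)%N -> rate (2 * (1 / 2)) t = t.-1%:R^-1 :> R.
Proof.
move=> t2; have e2 : 2 * (1 / 2) = 1 :> R by lra.
by rewrite rateE// e2 powR_inv1.
Qed.

Lemma max_step_small t w : (1 <= t < T)%N ->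
  enorm (x t.+1 w - x t w) <= Rad * rate (2 * (1 / 2)) t.+1.
Proof.
move=> tT; have tT' : (1 <= t <= T)%N by nat_lia.
have [[Kv _] ->] := upd w tT'.
rewrite [x t w + _ - _]addrAC subrr add0r enormZ ger0_norm ?invr_ge0// mulrC.
rewrite ler_pM ?enorm_ge0 ?invr_ge0 ?radK//.
rewrite rate_inv; last by nat_lia.
rewrite lef_pV2 ?posrE ?ltr0n//; last by nat_lia.
by rewrite ler_nat; nat_lia.
Qed.

(** By [submodular_first_order] a step of size 1/T contracts the suboptimality by
    1 - 1/T, up to errors; after T steps a fraction (1 - 1/T)^T <= 1/e of the initial
    one, at most F xstar, is left. *)
Lemma submodular_rate (Xi : 'I_d -> set R) xstar :
  (forall i, compact (Xi i) /\ Xi i `<=` [set r | 0 <= r]) ->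
  K `<=` box Xi -> monotone_on (box Xi) F -> dr_submodular (box Xi) F ->
  is_argmax K F xstar ->
  (forall w, K (x T.+1 w)) /\
  (((1 - expR (- 1)) * F xstar
     - (D * noise_cost Rad + L * Rad ^+ 2) * T%:R `^ (- (1 / 2)))%:E
   <= 'E_P[fun w => F (x T.+1 w)])%E.
Proof.
move=> XiP K_box monoF subF [Kxs xsmax].
have Xi_ge0 i : Xi i `<=` [set r | 0 <= r] by have [] := XiP i.
have b01 : 0 <= (1 / 2 : R) <= 1 / 2 by lra.
have rho_rate t : (2 <= t <= T)%N -> t.-1%:R^-1 = rate (2 * (1 / 2)) t :> R.
  by move=> tT; rewrite rate_inv//; nat_lia.
split=> [w|]; first by apply: max_iterate_in; nat_lia.
have mean_ex : \int[P]_w (\sum_(i < T) excess F x g (1 / 2) i.+1 w) <=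
    noise_cost Rad * T%:R `^ (1 - 1 / 2).
  rewrite (_ : noise_cost Rad * _ =
    ((2 * L * Rad + 2 * G) ^+ 2 + 1) / 2 * (3 * T%:R `^ (1 - 1 / 2))).
    exact: (mean_sum_excess_le grad_meas mean_grad grad_le grad_lip est
      max_update_affine max_iterate_in b01 L_ge0 Rad_ge0 rho_rate max_step_small).
  by rewrite /noise_cost; ring.
have ex_bm := sum_excess_bm grad_meas mean_grad grad_le grad_lip est
  max_update_affine max_iterate_in b01 L_ge0 Rad_ge0 rho_rate max_step_small.
have Fbm : bounded_measurable (fun w => F (x T.+1 w)).
  apply: (value_bm est max_update_affine max_iterate_in
    (objective_lip convK diffF gFle) Fle); nat_lia.
rewrite expectationE// lee_fin.
pose c : R := T%:R^-1.
have c0 : 0 <= c by rewrite invr_ge0.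
have c1 : c <= 1 by rewrite invf_le1 ?ltr0n// ler1n.
have path w : (1 - expR (- 1)) * F xstar - L * Rad ^+ 2 * c
    + - (c * D) * (\sum_(i < T) excess F x g (1 / 2) i.+1 w) <= F (x T.+1 w).
  have ex0 t : 0 <= excess F x g (1 / 2) t w.
    have r0 : 0 < rate (1 / 2) t :> R by exact: rate_gt0.
    apply: divr_ge0 => //; apply: addr_ge0; last exact: ltW.
    by apply: divr_ge0; [exact: dotv_ge0|exact: ltW].
  have := @contraction_sum_le R (1 - c) (fun i => F xstar - F (x i.+1 w))
    (fun i => c * D * excess F x g (1 / 2) i.+1 w + L * Rad ^+ 2 * c ^+ 2) T.
  rewrite subr_ge0 c1 gerBl c0 => /(_ isT) tel.
  have {}tel : F xstar - F (x T.+1 w) <= (1 - c) ^+ T * (F xstar - F (x 1 w)) +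
     \sum_(i < T) (c * D * excess F x g (1 / 2) i.+1 w + L * Rad ^+ 2 * c ^+ 2).
    apply: tel => i iT.
      by rewrite addr_ge0 ?(mulr_ge0 _ (ex0 _)) ?(mulr_ge0 _ (sqr_ge0 _)) ?mulr_ge0.
    have iT' : (1 <= i.+1 <= T)%N by nat_lia.
    have [[Kv vmax] xE] := upd w iT'.
    have Kx : K (x i.+1 w) by apply: max_iterate_in; nat_lia.
    have Kx' : K (x i.+1 w + c *: v i.+1 w).
      by rewrite -xE; apply: max_iterate_in; nat_lia.
    have := @submodular_step _ _ K F L D convK L_ge0 diffF gFlip diamK
      (x i.+1 w) (v i.+1 w) xstar (g i.+1 w) c (rate (1 / 2) i.+1) Rad
      Kx Kv Kxs Kx' (radK Kv) c0 (rate_gt0 _ _) (vmax _ Kxs).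
    rewrite -xE -/(err F x g i.+1 w) -/(sq_err F x g i.+1 w)
      -/(excess F x g (1 / 2) i.+1 w).
    have := submodular_first_order convK diffF Xi_ge0 K_0 K_box monoF subF Kx Kxs.
    exact: submodular_step_algebra.
  rewrite big_split/= sumr_const card_ord -mulr_sumr in tel.
  have x1E : x 1 w = 0 by rewrite (sfw_x_init est).
  have F0 : 0 <= F (x 1 w) by rewrite x1E; apply: (proj1 subF); exact: K_box.
  have Fs : F (x 1 w) <= F xstar by apply: xsmax; rewrite x1E.
  have qT : (1 - c) ^+ T <= expR (- 1) by exact: onem_inv_exp_le.
  have e0 : 0 <= expR (- 1) :> R by rewrite expR_ge0.
  have h : (1 - c) ^+ T * (F xstar - F (x 1 w)) <= expR (- 1) * F xstar.
    by rewrite ler_pM ?exprn_ge0 ?subr_ge0// gerBl.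
  have cT : (L * Rad ^+ 2 * c ^+ 2) *+ T = L * Rad ^+ 2 * c.
    by rewrite -mulr_natl /c; field; rewrite gt_eqF.
  rewrite cT in tel; rewrite mulNr.
  move: (expR (- 1)) ((1 - c) ^+ T * _) (L * Rad ^+ 2 * c) (c * D * _) h tel.
  move=> e a l b h tel; lra.
have lhs_bm := bmD (bm_cst ((1 - expR (- 1)) * F xstar - L * Rad ^+ 2 * c))
  (bmZ (- (c * D)) ex_bm).
apply: le_trans (mean_le P lhs_bm Fbm path).
rewrite (meanD P (bm_cst _) (bmZ _ ex_bm)) (meanZ P _ ex_bm) mean_cst.
have cD : 0 <= c * D by rewrite mulr_ge0.
pose r : R := T%:R `^ (- (1 / 2)).
have c_r : c <= r.
  by rewrite /c -powR_inv1 ?ler0n//; apply: ge1_powRN_le => //; lra.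
have cost : c * D * \int[P]_w (\sum_(i < T) excess F x g (1 / 2) i.+1 w) <=
    D * noise_cost Rad * r.
  apply: le_trans (ler_wpM2l cD mean_ex) _; rewrite powR_onem// -/r /c.
  rewrite le_eqVlt; apply/orP; left; apply/eqP; field.
  by rewrite gt_eqF.
have : L * Rad ^+ 2 * c <= L * Rad ^+ 2 * r by rewrite ler_wpM2l ?mulr_ge0 ?sqr_ge0.
rewrite -/r mulNr.
move: (c * D * _) (L * Rad ^+ 2) cost => m l cost lc; lra.
Qed.

End MaxUpdate.

End Algorithms.

Theorem theorem4 (R : realType) (B G L D Rad : R) :
  exists c : R,
  forall (d : nat) (K : set 'rV[R]_d)
    (dZ : measure_display) (Z : measurableType dZ) (p : probability Z R)
    (Ft : 'rV[R]_d -> Z -> R) (F : 'rV[R]_d -> R),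
  K !=set0 ->
  @convex_set R 'rV[R]_d K ->
  compact K ->
  is_max [set enorm (x - y) | x in K & y in K] D ->
  is_max [set enorm x | x in K] Rad ->
  (forall z x, differentiable (Ft ^~ z) x) ->
  (forall x, K x -> differentiable F x) ->
  (forall x, measurable_fun setT (Ft x)) ->
  (forall x i, measurable_fun setT (fun z => grad (Ft ^~ z) x ord0 i)) ->
  (forall x, K x -> ('E_p[Ft x] = (F x)%:E)%E) ->
  (forall x i, K x ->
     ('E_p[fun z => grad (Ft ^~ z) x ord0 i] = (grad F x ord0 i)%:E)%E) ->
  (forall x z, K x -> `|Ft x z| <= B) ->
  (forall x z, K x -> enorm (grad (Ft ^~ z) x) <= G) ->
  (forall x y z, K x -> K y ->
     enorm (grad (Ft ^~ z) x - grad (Ft ^~ z) y) <= L * enorm (x - y)) ->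
  forall (dO : measure_display) (Omega : measurableType dO)
    (P : probability Omega R) (T : nat)
    (z : nat -> Omega -> Z) (x g v : nat -> Omega -> 'rV[R]_d),
  (1 <= T)%N ->
  [/\ (forall x1 xstar : 'rV[R]_d,
       @convex_function R 'rV[R]_d K F ->
       is_argmin K F xstar ->
       K x1 ->
       sfw_estimator p P Ft T (fun t => (t.-1%:R)^-1) x1 z x g v ->
       min_update K T (fun t => t%:R^-1) x g v ->
       (forall w, K (x T.+1 w)) /\
       ('E_P[fun w => (F (x T.+1 w) - F xstar)%R]
          <= (c * T%:R `^ (- (1 / 2)))%:E)%E),
      (forall (x1 : 'rV[R]_d) (iota : Omega -> nat),
       K x1 ->
       sfw_estimator p P Ft T (fun t => t.-1%:R `^ (- (2 / 3))) x1 z x g v ->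
       min_update K T (fun=> T%:R `^ (- (2 / 3))) x g v ->
       uniform_index P T z v iota ->
       (forall w, K (x (iota w) w)) /\
       ('E_P[fun w => fw_gap K F (x (iota w) w)]
          <= (c * T%:R `^ (- (1 / 3)))%:E)%E) &
      (forall (Xi : 'I_d -> set R) (xstar : 'rV[R]_d),
       K 0 ->
       (forall i, compact (Xi i) /\ Xi i `<=` [set r | 0 <= r]) ->
       K `<=` box Xi ->
       monotone_on (box Xi) F ->
       dr_submodular (box Xi) F ->
       is_argmax K F xstar ->
       sfw_estimator p P Ft T (fun t => (t.-1%:R)^-1) 0 z x g v ->
       dr_max_update K T (fun=> T%:R^-1) x g v ->
       (forall w, K (x T.+1 w)) /\
       (((1 - expR (- 1)) * F xstar - c * T%:R `^ (- (1 / 2)))%:E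
          <= 'E_P[fun w => F (x T.+1 w)])%E)].
Proof.
pose c1 := D * noise_cost G `|L| D + 3 * `|L| * D ^+ 2.
pose c2 := 2 * B + D * noise_cost G `|L| D + `|L| * D ^+ 2.
pose c3 := D * noise_cost G `|L| Rad + `|L| * Rad ^+ 2.
pose c := Num.max c1 (Num.max c2 c3).
exists c.
move=> d K dZ Z p Ft F K0 convK compK [_ diam_ub] [_ rad_ub] _ diffF Ft_meas.
move=> grad_meas mean_Ft mean_grad Ft_le grad_le grad_lip dO Omega P T z x g v T_gt0.
(* L itself is negative only if K is a single point. *)
have L_ge0 : 0 <= `|L| by [].
have diamK a b : K a -> K b -> enorm (a - b) <= D.
  by move=> Ka Kb; apply: diam_ub; exists a => //; exists b.
have radK a : K a -> enorm a <= Rad by move=> Ka; apply: rad_ub; exists a.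
have grad_lip' a b s : K a -> K b ->
    enorm (grad (Ft ^~ s) a - grad (Ft ^~ s) b) <= `|L| * enorm (a - b).
  move=> Ka Kb; apply: le_trans (grad_lip a b s Ka Kb) _.
  by rewrite ler_wpM2r ?enorm_ge0// ler_norm.
have le_c a b : a <= c -> a * T%:R `^ b <= c * T%:R `^ b.
  by move=> ac; rewrite ler_wpM2r ?powR_ge0.
split.
- move=> x1 xstar cF xsmin Kx1 est upd.
  have [Kx rate_le] := convex_rate convK K0 L_ge0 diamK diffF Ft_meas grad_meas
    mean_Ft mean_grad Ft_le grad_le grad_lip' T_gt0 cF xsmin Kx1 est upd.
  split=> //; apply: le_trans rate_le _; rewrite lee_fin le_c//.
  by rewrite /c le_max lexx.
- move=> x1 iota Kx1 est upd unif.
  have [Kx rate_le] := nonconvex_rate convK compK K0 L_ge0 diamK diffF Ft_meas grad_meas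
    mean_Ft mean_grad Ft_le grad_le grad_lip' T_gt0 Kx1 est upd unif.
  split=> //; apply: le_trans rate_le _; rewrite lee_fin le_c//.
  by rewrite /c !le_max lexx orbT.
- move=> Xi xstar K_0 XiP K_box monoF subF xsmax est upd.
  have [Kx rate_le] := submodular_rate convK K0 L_ge0 diamK radK diffF Ft_meas
    grad_meas mean_Ft mean_grad Ft_le grad_le grad_lip' T_gt0 K_0 est upd XiP K_box
    monoF subF xsmax.
  split=> //; apply: le_trans rate_le; rewrite lee_fin lerD2l lerN2 le_c//.
  by rewrite /c !le_max lexx !orbT.
Qed.
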